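(* There is a polynomial-time algorithm that, given a finite bipartite graph $G$ with bipartition $(X,Y)$, decides whether $G$ is a cocomparability bigraph; moreover, the algorithm finds a $T$-free orientation of $\overline{G}$ if $G$ is a cocomparability bigraph, and otherwise exhibits a weak edge-asteroid of $G$ certifying that $G$ is not a cocomparability bigraph.
   Context: $G$ is a cocomparability bigraph if there exist linear orderings $\prec_X$ of $X$ and $\prec_Y$ of $Y$ such that for all $u,v\in X$, $w,z\in Y$ with $u\prec_X v$, $w\prec_Y z$ and $uz,vw\in E(G)$, at least one of $uw,vz$ is in $E(G)$. An orientation of the complement $\overline{G}$ is a mixed graph in which every non-edge $xy$ of $G$ with $x\in X,y\in Y$ is an undirected edge and every pair of distinct vertices both in $X$ or both in $Y$ is oriented in exactly one direction; it is $T$-free if there are no $x,x'\in X$, $y,y'\in Y$ with $xy,x'y'\notin E(G)$, $xy',x'y\in E(G)$, and arcs $x\to x'$, $y\to y'$. A weak edge-asteroid in $G$ is a family of $2k+1$ ($k\ge1$) edges $e_0,\dots,e_{2k}$, not necessarily distinct, such that for each $i$ there is a walk containing both end vertices of $e_{i+k}$ and both end vertices of $e_{i+k+1}$ and no vertex adjacent to an end vertex of $e_i$ (indices mod $2k+1$). *)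

(* Defs.v *)
From mathcomp Require Import all_boot all_algebra.

Set Implicit Arguments.
Unset Strict Implicit.
Unset Printing Implicit Defensive.

(** * Bipartite graphs with a fixed bipartition *)

(* The second part Y is the complement of [partX]. *)
Record bigraph (T : finType) := Bigraph {
  adj : rel T;
  partX : {set T};
  adj_sym : symmetric adj;
  adj_bip : forall u v, adj u v -> (u \in partX) != (v \in partX) }.

Definition partY (T : finType) (G : bigraph T) : {set T} := ~: partX G.

Definition strict_linear_order_on (T : finType) (A : {set T}) (lt : rel T) :=
  [/\ {in A, forall x, ~~ lt x x},
      {in A & &, transitive lt}
    & {in A &, forall x y, x != y -> lt x y || lt y x}].

Definition cocomparability_bigraph (T : finType) (G : bigraph T) : Prop :=
  exists ltX ltY : rel T,
    [/\ strict_linear_order_on (partX G) ltX,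
        strict_linear_order_on (partY G) ltY
      & forall u v w z,
          u \in partX G -> v \in partX G -> w \in partY G -> z \in partY G ->
          ltX u v -> ltY w z -> adj G u z -> adj G v w ->
          adj G u w || adj G v z].

(** * Orientations of the complement *)

Record mixed_graph (T : finType) := MixedGraph {
  undirected : rel T;
  directed : rel T }.

Definition orientation_of_complement (T : finType) (G : bigraph T)
    (M : mixed_graph T) : Prop :=
  [/\ forall u v, undirected M u v =
        ((u \in partX G) != (v \in partX G)) && ~~ adj G u v,
      forall u v, directed M u v ->
        u != v /\ (u \in partX G) = (v \in partX G)
    & forall u v, u != v -> (u \in partX G) = (v \in partX G) ->
        directed M u v (+) directed M v u].

Definition T_free (T : finType) (G : bigraph T) (M : mixed_graph T) : Prop :=
  ~ exists x x' y y',
      [/\ [/\ x \in partX G, x' \in partX G, y \in partY G & y' \in partY G],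
          ~~ adj G x y /\ ~~ adj G x' y',
          adj G x y' /\ adj G x' y
        & directed M x x' /\ directed M y y'].

(** * Weak edge-asteroids *)

(* An edge is given by an ordered pair of its end vertices. *)
Definition is_edge (T : finType) (G : bigraph T) (e : T * T) : bool :=
  adj G e.1 e.2.

Definition avoiding_walk (T : finType) (G : bigraph T) (e f g : T * T) : Prop :=
  exists (x : T) (p : seq T),
    [/\ path (adj G) x p,
        {subset [:: f.1; f.2; g.1; g.2] <= x :: p}
      & {in x :: p, forall w, ~~ adj G w e.1 && ~~ adj G w e.2}].

(* [inZp i] is the residue of [i : nat] modulo [2k+1]. *)
Definition weak_edge_asteroid (T : finType) (G : bigraph T) (k : nat)
    (e : 'I_k.*2.+1 -> T * T) : Prop :=
  [/\ 0 < k,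
      forall i, is_edge G (e i)
    & forall i : 'I_k.*2.+1,
        avoiding_walk G (e i) (e (inZp (i + k))) (e (inZp (i + k + 1)))].

(** * Random-access machines *)

(* Programs of a unit-cost RAM with finitely many registers in use, an
   unbounded memory with indirect addressing, and structured control.  The
   only arithmetic is addition and truncated subtraction: a step lengthens the
   largest number in binary by at most one bit (up to the constants of the
   program), so running times are polynomially related to those of Turing
   machines.  Multiplication at unit cost would break this. *)
Inductive program : Type :=
| Skip
| Const (r c : nat)
| Add (r a b : nat)
| Sub (r a b : nat)
| Read (r a : nat)                (* r := memory[a] *)
| Write (a r : nat)               (* memory[a] := r *)
| Seq (p q : program)
| If (r : nat) (p q : program)    (* tests r <> 0 *)
| While (r : nat) (p : program).  (* loops as long as r <> 0 *)

Record state := State { reg : nat -> nat; mem : nat -> nat }.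

Definition update (f : nat -> nat) (i v : nat) : nat -> nat :=
  fun j => if j == i then v else f j.

Definition set_reg (s : state) (r v : nat) : state :=
  State (update (reg s) r v) (mem s).

Definition set_mem (s : state) (a v : nat) : state :=
  State (reg s) (update (mem s) a v).

(* [exec p s t s'] : started in [s], [p] halts in [s'] after [t] steps. *)
Inductive exec : program -> state -> nat -> state -> Prop :=
| exec_skip s :
    exec Skip s 1 s
| exec_const s r c :
    exec (Const r c) s 1 (set_reg s r c)
| exec_add s r a b :
    exec (Add r a b) s 1 (set_reg s r (reg s a + reg s b))
| exec_sub s r a b :
    exec (Sub r a b) s 1 (set_reg s r (reg s a - reg s b))
| exec_read s r a :
    exec (Read r a) s 1 (set_reg s r (mem s (reg s a)))
| exec_write s a r :
    exec (Write a r) s 1 (set_mem s (reg s a) (reg s r))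
| exec_seq p q s1 t1 s2 t2 s3 :
    exec p s1 t1 s2 -> exec q s2 t2 s3 -> exec (Seq p q) s1 (t1 + t2) s3
| exec_if_true r p q s t s' :
    reg s r != 0 -> exec p s t s' -> exec (If r p q) s t.+1 s'
| exec_if_false r p q s t s' :
    reg s r = 0 -> exec q s t s' -> exec (If r p q) s t.+1 s'
| exec_while_true r p s1 t1 s2 t2 s3 :
    reg s1 r != 0 -> exec p s1 t1 s2 -> exec (While r p) s2 t2 s3 ->
    exec (While r p) s1 (t1 + t2).+1 s3
| exec_while_false r p s :
    reg s r = 0 -> exec (While r p) s 1 s.

Definition initial_state (w : seq nat) : state :=
  State (fun _ => 0) (nth 0 w).

(* Memory cells beyond the output word are scratch space. *)
Definition holds_output (s : state) (w : seq nat) : Prop :=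
  forall i, i < size w -> mem s i = nth 0 w i.

(* [p] halts on input [w] within [N] steps with output [out]. *)
Definition computes_within (p : program) (w : seq nat) (N : nat)
    (out : seq nat) : Prop :=
  exists t s,
    [/\ exec p (initial_state w) t s, t <= N & holds_output s out].

(** * Input and output words *)

(* The number of vertices, the indicator word of X, and the adjacency matrix in
   row-major order.  All entries are at most n, and the word has length
   1 + n + n^2, so this length is an honest measure of the input size. *)
Definition encode_bigraph (n : nat) (G : bigraph 'I_n) : seq nat :=
  n :: [seq nat_of_bool (u \in partX G) | u <- enum 'I_n]
    ++ [seq nat_of_bool (adj G u v) | u <- enum 'I_n, v <- enum 'I_n].

(* Leading 1 for acceptance, then the n x n matrix with entries 0 (no arc from
   u to v, no edge), 1 (undirected edge uv), 2 (arc u -> v). *)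
Definition encode_yes (n : nat) (M : mixed_graph 'I_n) : seq nat :=
  1 :: [seq undirected M u v + (directed M u v).*2
         | u <- enum 'I_n, v <- enum 'I_n].

(* Leading 0 for rejection, then k, then the end vertices of the 2k+1 edges. *)
Definition encode_no (n k : nat) (e : 'I_k.*2.+1 -> 'I_n * 'I_n) : seq nat :=
  0 :: k :: flatten [seq [:: nat_of_ord (e i).1; nat_of_ord (e i).2]
                      | i <- enum 'I_k.*2.+1].

(* Main.v *)
Require Import Defs.
From mathcomp Require Import all_boot all_algebra.
From mathcomp Require Import zify.

(* If [x p] and [y q] are edges and [x q] and [y p] are not, then [x < y] if and
   only if [p < q] in any two orderings that witness a cocomparability bigraph;
   the same equivalence expresses [T]-freeness of an orientation.  So the pairs
   [(x, y)] on one side fall into classes of pairs that are oriented together.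

   If the class of some [(x, y)] contains [(y, x)], then a chain between them is
   a closed walk whose antipodal edges avoid each other, and all but one of its
   edges form a weak edge-asteroid.  Conversely, the orderings turn the edges of
   an asteroid into an odd cycle of alternating comparisons.

   If no class is its own reverse, orienting every class arbitrarily is [T]-free,
   but may contain cyclic triangles.  Orienting a class from its lexicographically
   least pair does not: in a cyclic triangle the class of each side forms a cyclic
   triangle with one and the same apex (an analogue of Golumbic's triangle lemma),
   which contradicts lexicographic minimality.  The resulting relation is
   transitive, and any linear extension witnesses a cocomparability bigraph.

   The algorithm therefore tabulates the pairs joined by a chain of given length,
   looks for a pair in the class of its reverse, and either follows a chain or
   compares the labels of the two classes of each pair. *)

Set Implicit Arguments.
Unset Strict Implicit.
Unset Printing Implicit Defensive.

Lemma horner_le N a b c d : d < N -> a * N + b <= c * N + d -> a <= c.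
Proof. nia. Qed.

(** * The forcing relation on pairs of vertices *)

Section Forcing.
Variables (T : finType) (G : bigraph T).
Implicit Types (x y z p q r : T) (u v w : T * T).

Local Notation E := (adj G).

(** When [u.1] and [u.2] lie on one side, the edges [u.1 v.1] and [u.2 v.2] form an induced
    matching. *)
Definition forces : rel (T * T) := fun u v =>
  [&& E u.1 v.1, E u.2 v.2, ~~ E u.1 v.2 & ~~ E u.2 v.1].

Definition swap u := (u.2, u.1).

Definition same_side x y := (x \in partX G) == (y \in partX G).

(** The excluded pairs are known as invertible pairs. *)
Definition conflict_free :=
  forall x y, x != y -> same_side x y -> ~~ connect forces (x, y) (y, x).

Lemma swapK : involutive swap. Proof. by case. Qed.

Lemma adjC x y : E x y = E y x. Proof. exact: adj_sym. Qed.

Lemma adj_side x y : E x y -> (y \in partX G) = (x \notin partX G).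
Proof. by move=> /(@adj_bip _ G); case: (x \in _); case: (y \in _). Qed.

Lemma same_side_nadj x y : same_side x y -> E x y = false.
Proof. by move/eqP=> s; apply/negP=> /(@adj_bip _ G); rewrite s eqxx. Qed.

Lemma forces_sym : symmetric forces.
Proof.
move=> [x y] [p q]; rewrite /forces /= (adjC p) (adjC q y) (adjC p y) (adjC q x).
by rewrite [~~ E y p && _]andbC.
Qed.

Lemma forces_swap u v : forces (swap u) (swap v) = forces u v.
Proof.
case: u v => [x y] [p q]; rewrite /forces /=.
by case: (E x p); case: (E y q); case: (E x q); case: (E y p).
Qed.

Lemma connect_forces_sym : connect_sym forces.
Proof. exact/sym_connect_sym/forces_sym. Qed.

Lemma forces_side u v : forces u v ->
  [/\ (v.1 \in partX G) = (u.1 \notin partX G)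
    & (v.2 \in partX G) = (u.2 \notin partX G)].
Proof. by case/and4P=> /adj_side-> /adj_side->. Qed.

Lemma forces_same_side u v :
  forces u v -> same_side u.1 u.2 -> same_side v.1 v.2.
Proof. by move=> /forces_side[s1 s2] /eqP s; rewrite /same_side s1 s2 s. Qed.

(** * Orientations without cyclic triangles *)

Section CyclicTriangles.
Variable R : rel T.
Hypothesis R_forces : forall u v, forces u v -> R u.1 u.2 -> R v.1 v.2.
Hypothesis R_asym : forall x y, R x y -> ~~ R y x.
Hypothesis R_forced : forall x y, R x y -> exists p q, forces (x, y) (p, q).
Hypothesis R_side : forall x y, R x y -> same_side x y.
Hypothesis R_total : forall x y p q,
  same_side x y -> forces (x, y) (p, q) -> R x y || R y x.

Definition cyclic3 x y z := [&& R x y, R y z & R z x].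

Lemma cyclic3_rot x y z : cyclic3 x y z = cyclic3 y z x.
Proof. by rewrite /cyclic3 andbC -andbA. Qed.

Lemma R_back x y p q : forces (x, y) (p, q) -> R p q -> R x y.
Proof. by rewrite forces_sym => /R_forces. Qed.

(** If [z] were adjacent to exactly one of [p] and [q], it could replace [x] or [y] in the forcing:
    [R p q] would then give [R z y] or [R x z], against the cyclic triangle. *)
Lemma cyclic3_twin x y z p q :
  cyclic3 x y z -> forces (x, y) (p, q) -> E z p = E z q.
Proof.
case/and3P=> xy yz zx f; have pq := R_forces f xy.
case/and4P: (f) => /= xp yq xq yp.
case zp: (E z p); case zq: (E z q) => //.
  have /R_back/(_ pq) zy: forces (z, y) (p, q) by apply/and4P; rewrite /= zp zq.
  by have := R_asym yz; rewrite zy.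
have /R_back/(_ pq) xz: forces (x, z) (p, q) by apply/and4P; rewrite /= zp zq.
by have := R_asym zx; rewrite xz.
Qed.

(** The witness [r] separates the apex [z] from both [x] and [y]. Along a forcing chain, [z] and [r]
    exchange roles at each step. *)
Definition linked x y z r :=
  [/\ cyclic3 x y z, E x r = ~~ E z r & E y r = ~~ E z r].

(** Take a pair [(q, r)] forced by [(y, z)]. By [cyclic3_twin], [x] is adjacent to both or to
    neither; then [q] or [r], respectively, separates [z] from [x] and [y]. *)
Lemma cyclic3_linked x y z : cyclic3 x y z -> exists r, linked x y z r.
Proof.
move=> c; have c' := c; rewrite cyclic3_rot in c'.
case/and3P: (c) => _ /R_forced[q [r f]] _; have tw := cyclic3_twin c' f.
case/and4P: f => /= yq zr yr zq.
case xq: (E x q) tw => xr; last by exists r; split=> //; rewrite zr -?xr // (negbTE yr).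
by exists q; split; rewrite // (negbTE zq) // xq.
Qed.

(** Once [z] is known to treat [p] and [q] opposite to [r], the arcs [q -> r] and [r -> p] are
    forced by [y -> z] and [z -> x], matched according to whether [z r] is an edge. *)
Lemma linked_forces x y z r p q :
  linked x y z r -> forces (x, y) (p, q) -> linked p q r z.
Proof.
case=> c xr yr f; have tw := cyclic3_twin c f.
have c' := c; rewrite cyclic3_rot in c'.
case/and3P: (c) => xy yz zx; case/and4P: (f) => /= xp yq xq yp.
have {tw} [zp zq]: E z p = ~~ E z r /\ E z q = ~~ E z r.
  suff zp: E z p = ~~ E z r by rewrite -tw.
  (* If [z] treated [p] like [r], then [(y, z)] would force two pairs that share one component and
     differ in the other, where [x] is adjacent to one choice only; [cyclic3_twin] forbids this. *)
  have [q' [r' f']] := R_forced yz; case/and4P: (f') => /= yq' zr' yr' zq'.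
  case zr: (E z r) xr yr => /= xr yr; case zp: (E z p) tw => //= zq.
    have f1: forces (y, z) (q', r) by apply/and4P; rewrite /= yr.
    have f2: forces (y, z) (q', p) by apply/and4P.
    have t1 := cyclic3_twin c' f1; have t2 := cyclic3_twin c' f2.
    by rewrite -t2 t1 xr in xp.
  have f1: forces (y, z) (r, r') by apply/and4P; rewrite /= zr.
  have f2: forces (y, z) (q, r') by apply/and4P; rewrite /= -zq.
  have t1 := cyclic3_twin c' f1; have t2 := cyclic3_twin c' f2.
  by rewrite t2 -t1 xr in xq.
split; rewrite ?(adjC r z) 1?(adjC _ z) //; apply/and3P; split; first exact: R_forces f xy.
  case zr: (E z r) zp zq xr yr => /= zp zq xr yr.
    by apply: (R_forces (u := (y, z)) (v := (q, r))) yz; apply/and4P; rewrite /= zq yr.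
  by apply: (R_forces (u := (z, x)) (v := (q, r))) zx; apply/and4P; rewrite /= zq xr zr.
case zr: (E z r) zp zq xr yr => /= zp zq xr yr.
  by apply: (R_forces (u := (z, x)) (v := (r, p))) zx; apply/and4P; rewrite /= zp xr.
by apply: (R_forces (u := (y, z)) (v := (r, p))) yz; apply/and4P; rewrite /= zp yr zr.
Qed.

Lemma linked_connect x y z r u : linked x y z r -> connect forces (x, y) u ->
  linked u.1 u.2 z r \/ linked u.1 u.2 r z.
Proof.
move=> l /connectP[s]; elim: s x y z r l => [|[p q] s IHs] x y z r l /=.
  by move=> _ ->; left.
by case/andP=> /(linked_forces l) l' ps /(IHs _ _ _ _ l' ps)[]; [right | left].
Qed.

(** The side of the pair reached thus decides which alternative of [linked_connect] holds. *)
Lemma linked_side x y z r : linked x y z r -> (z \in partX G) != (r \in partX G).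
Proof.
case=> /and3P[_ _ /R_side/eqP zx] xr _.
case: (boolP (E z r)) xr => [/(@adj_bip _ G) // | _ /= xr].
by rewrite zx adj_bip.
Qed.

(* The apex [z] is the same for all pairs of the class on the side of [x]. *)
Lemma cyclic3_connect x y z u : cyclic3 x y z -> connect forces (x, y) u ->
  same_side x u.1 -> cyclic3 u.1 u.2 z.
Proof.
move=> c xyu xu; have [r l] := cyclic3_linked c.
have := linked_side l; have [[] // | []] := linked_connect l xyu.
case/and3P=> _ _ /R_side/eqP -> _ _; case/and3P: c => _ _ /R_side/eqP->.
by rewrite (eqP xu) eqxx.
Qed.

Lemma cyclic3_connect_ex x y z u : cyclic3 x y z -> connect forces (x, y) u ->
  exists z', cyclic3 u.1 u.2 z'.
Proof.
move=> c xyu; have [r l] := cyclic3_linked c.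
by case: (linked_connect l xyu) => [[] | []]; [exists z | exists r].
Qed.

(** By [R_total] it is enough that [(x, z)] forces something, as [z -> x] would close a cyclic
    triangle. *)
Lemma R_trans : (forall x y z, ~~ cyclic3 x y z) -> transitive R.
Proof.
move=> acyc y x z xy yz.
have xz_side: same_side x z by rewrite /same_side (eqP (R_side xy)) (eqP (R_side yz)).
suff [p [q f]]: exists p q, forces (x, z) (p, q).
  by case/orP: (R_total xz_side f) => // zx; have := acyc x y z; rewrite /cyclic3 xy yz zx.
have [a [b0 f0]] := R_forced xy; have [b1 [c f1]] := R_forced yz.
case/and4P: (f0) => /= xa yb0 xb0 ya; case/and4P: (f1) => /= yb1 zc yc zb1.
(* A neighbour [b] of [y] adjacent to neither [x] nor [z] serves both pairs, and then [(x, z)]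
   forces [(a, c)]. Otherwise [b0] is adjacent to [z] and [b1] to [x], and [(x, z)] forces
   [(b1, b0)]. *)
have [b /and3P[yb xb zb] | nob] := pickP (fun b => [&& E y b, ~~ E x b & ~~ E z b]).
  have fab: forces (x, y) (a, b) by apply/and4P.
  have fbc: forces (y, z) (b, c) by apply/and4P.
  exists a, c; apply/and4P; split=> //=; apply/negP=> h.
    have /R_back/(_ (R_forces fbc yz)): forces (y, x) (b, c) by apply/and4P.
    by apply/negP/R_asym.
  have /R_back/(_ (R_forces fab xy)): forces (z, y) (a, b) by apply/and4P.
  by apply/negP/R_asym.
have := nob b0; have := nob b1; rewrite yb0 yb1 xb0 zb1 /= andbT => /negbFE xb1 /negbFE zb0.
by exists b1, b0; apply/and4P.
Qed.

End CyclicTriangles.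

(** * The lexicographic orientation *)

Definition pair_code u := enum_rank u.1 * #|T| + enum_rank u.2.

Lemma pair_code_lt x y u :
  pair_code u < pair_code (x, y) -> enum_rank u.1 <= enum_rank x.
Proof. by move/ltnW/horner_le; apply; apply: ltn_ord. Qed.

Lemma pair_code_le x y u :
  pair_code (x, y) <= pair_code u -> enum_rank x <= enum_rank u.1.
Proof. by move/horner_le; apply; apply: ltn_ord. Qed.

Lemma pair_code_inj : injective pair_code.
Proof.
move=> [x y] [x' y'] eq_c; have e1: x = x'.
  apply/enum_rank_inj/val_inj/eqP; rewrite eqn_leq /=.
  apply/andP; split; first by apply: (@pair_code_le x y (x', y')); rewrite eq_c.
  by apply: (@pair_code_le x' y' (x, y)); rewrite eq_c.
by move: eq_c; rewrite e1 /pair_code /= => /addnI/val_inj/enum_rank_inj->.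
Qed.

(** The last clause compares the least codes of two reverse classes without naming them. Pairs that
    force nothing stay unrelated, as [R_forced] demands, and are left to the linear extension. *)
Definition lexR x y :=
  [&& same_side x y, [exists u, forces (x, y) u]
    & [exists u, connect forces u (x, y)
         && [forall v, connect forces v (y, x) ==> (pair_code u < pair_code v)]]].

Section LexicographicOrientation.
Hypothesis noconf : conflict_free.

Lemma lexR_forces u v : forces u v -> lexR u.1 u.2 -> lexR v.1 v.2.
Proof.
move=> f; have f' := f; rewrite -forces_swap in f'.
case: u v f f' => [x y] [p q] f f' /=; case/and3P=> s _ /existsP[u /andP[cu /forallP min_u]].
apply/and3P; split; first exact: forces_same_side f s.
  by apply/existsP; exists (x, y); rewrite forces_sym.
apply/existsP; exists u; rewrite (connect_trans cu (connect1 f)) /=.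
apply/forallP=> v; apply/implyP=> cv; apply: (implyP (min_u v)).
by apply: connect_trans cv _; rewrite connect_forces_sym connect1.
Qed.

Lemma lexR_asym x y : lexR x y -> ~~ lexR y x.
Proof.
case/and3P=> _ _ /existsP[u /andP[cu /forallP min_u]]; apply/negP.
case/and3P=> _ _ /existsP[v /andP[cv /forallP min_v]].
by have := implyP (min_u v) cv; have := implyP (min_v u) cu; lia.
Qed.

(** The least codes of the two classes differ, since a common pair would put [(x, y)] in the class
    of [(y, x)]. *)
Lemma lexR_total x y p q :
  same_side x y -> forces (x, y) (p, q) -> lexR x y || lexR y x.
Proof.
move=> s f.
have neq_xy: x != y.
  by apply: contraL f => /eqP->; rewrite /forces /=; case: (E y p); case: (E y q).
have noc := noconf neq_xy s.
have s': same_side y x by rewrite /same_side eq_sym.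
have nt: [exists u, forces (x, y) u] by apply/existsP; exists (p, q).
have nt': [exists u, forces (y, x) u].
  by apply/existsP; exists (q, p); rewrite -(forces_swap (x, y) (p, q)) in f.
have [u cu min_u] := @arg_minnP _ (x, y) (fun u => connect forces u (x, y))
  pair_code (connect0 _ _).
have [v cv min_v] := @arg_minnP _ (y, x) (fun u => connect forces u (y, x))
  pair_code (connect0 _ _).
rewrite /lexR s s' nt nt' /=; case: (ltngtP (pair_code u) (pair_code v)) => [lt|lt|eq].
- apply/orP; left; apply/existsP; exists u; rewrite cu; apply/forallP=> w.
  by apply/implyP=> /min_v; apply: leq_trans.
- apply/orP; right; apply/existsP; exists v; rewrite cv; apply/forallP=> w.
  by apply/implyP=> /min_u; apply: leq_trans.
- case/negP: noc; rewrite (connect_trans _ cv) // -(pair_code_inj eq).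
  by rewrite connect_forces_sym.
Qed.

Lemma lexR_forced x y : lexR x y -> exists p q, forces (x, y) (p, q).
Proof. by case/and3P=> _ /existsP[[p q] f] _; exists p, q. Qed.

Lemma lexR_side x y : lexR x y -> same_side x y.
Proof. by case/and3P. Qed.

(* In a cyclic triangle [x -> y -> z -> x] with [pair_code (x, y)] minimal, the
   least pair of the class of [(z, x)] starts in [x]; its class has apex [y], so
   that [y -> x]. *)
Lemma lexR_acyclic x y z : ~~ cyclic3 lexR x y z.
Proof.
pose P n := [exists a, exists b, exists c, cyclic3 lexR a b c && (pair_code (a, b) == n)].
apply/negP=> c0; have exP: exists n, P n.
  exists (pair_code (x, y)).
  by apply/existsP; exists x; apply/existsP; exists y; apply/existsP; exists z; rewrite c0 /=.
have [n /existsP[a /existsP[b /existsP[c /andP[cyc /eqP en]]]] min_n] := ex_minnP exP.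
(* Each pair in the class of [(c, a)] lies in a cyclic triangle itself, so minimality applies to its
   code. *)
have lower u : connect forces (c, a) u -> pair_code (a, b) <= pair_code u.
  have cyc' : cyclic3 lexR c a b by rewrite cyclic3_rot.
  move=> /(cyclic3_connect_ex lexR_forces lexR_asym lexR_forced cyc')[d cd].
  rewrite en; apply: min_n; apply/existsP; exists u.1; apply/existsP; exists u.2.
  by apply/existsP; exists d; rewrite cd; case: (u) => /= ? ?.
have cyc' : cyclic3 lexR c a b by rewrite cyclic3_rot.
case/and3P: (cyc) => ab _ ca; case/and3P: (ca) => s_ca _ /existsP[u /andP[cu min_u]].
have lt_u := implyP (forallP min_u (a, c)) (connect0 _ _).
rewrite connect_forces_sym in cu.
(* [u] precedes [(a, c)], so its first entry ranks at most as high as [a]; [lower] gives the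
   converse. *)
have eu: u.1 = a.
  apply/enum_rank_inj/val_inj/eqP; rewrite eqn_leq /=.
  by rewrite (pair_code_lt lt_u) (pair_code_le (lower _ cu)).
have := cyclic3_connect lexR_forces lexR_asym lexR_forced lexR_side cyc' cu.
rewrite eu => /(_ s_ca) /and3P[_ _ ba].
by have := lexR_asym ab; rewrite ba.
Qed.

Lemma lexR_trans : transitive lexR.
Proof.
exact: R_trans lexR_forces lexR_asym lexR_forced lexR_side lexR_total lexR_acyclic.
Qed.

(** The number of predecessors grows along a transitive asymmetric relation; [enum_rank] breaks
    ties, so the ranks give a linear extension. *)
Definition lex_rank x := #|[set y | lexR y x]| * #|T| + enum_rank x.

Lemma lexR_rank x y : lexR x y -> lex_rank x < lex_rank y.
Proof.
move=> xy; suff: #|[set z | lexR z x]| < #|[set z | lexR z y]|.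
  move=> lt; rewrite ltnNge; apply/negP=> le.
  by have := horner_le (ltn_ord _) le; rewrite leqNgt lt.
apply/proper_card/properP; split.
  by apply/subsetP=> z; rewrite !inE => /lexR_trans; apply.
exists x; rewrite !inE //; apply/negP=> xx.
by have := lexR_asym xx; rewrite xx.
Qed.

Lemma lex_rank_inj : injective lex_rank.
Proof.
move=> x y; rewrite /lex_rank => e; apply/enum_rank_inj/val_inj => /=.
have := congr1 (modn^~ #|T|) e; rewrite !modnMDl !modn_small //; exact: ltn_ord.
Qed.

Lemma conflict_free_cocomparability : cocomparability_bigraph G.
Proof.
have lin A : strict_linear_order_on A (fun x y => lex_rank x < lex_rank y).
  split=> [x _ | x y z _ _ _ | x y _ _ neq]; rewrite ?ltnn //; first exact: ltn_trans.
  by rewrite -neq_ltn; apply: contra_neq neq; apply: lex_rank_inj.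
exists (fun x y => lex_rank x < lex_rank y), (fun x y => lex_rank x < lex_rank y).
split=> // u v w z uX vX _ _ uv wz uz vw.
case uw: (E u w) => //=; apply/negPn/negP=> vz.
(* Either [u -> v], and then [z -> w] although [w] ranks before [z], or [v -> u] although [u] ranks
   before [v]. *)
have f: forces (u, v) (z, w) by apply/and4P; rewrite /= uw.
have s: same_side u v by rewrite /same_side uX vX.
case/orP: (lexR_total s f) => [/(lexR_forces f)/= zw | /lexR_rank]; last by lia.
by have := lexR_rank zw; lia.
Qed.

End LexicographicOrientation.

(** * Weak edge-asteroids *)

Section OrderObstruction.
Variables ltX ltY : rel T.
Hypothesis linX : strict_linear_order_on (partX G) ltX.
Hypothesis linY : strict_linear_order_on (partY G) ltY.
Hypothesis cocomp : forall u v w z : T,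
  u \in partX G -> v \in partX G -> w \in partY G -> z \in partY G ->
  ltX u v -> ltY w z -> E u z -> E v w -> E u w || E v z.

Definition endX u := if u.1 \in partX G then u.1 else u.2.
Definition endY u := if u.1 \in partX G then u.2 else u.1.

Definition after u x := if x \in partX G then ltX (endX u) x else ltY (endY u) x.

Lemma endsP u : is_edge G u ->
  [/\ endX u \in partX G, endY u \notin partX G & E (endX u) (endY u)].
Proof.
rewrite /is_edge /endX /endY => e; have := adj_side e.
by case: ifP => uX s; rewrite ?uX ?s ?uX // adjC.
Qed.

Lemma avoid_ends u x : ~~ E x u.1 && ~~ E x u.2 ->
  E x (endX u) = false /\ E x (endY u) = false.
Proof. by rewrite /endX /endY => /andP[/negbTE n1 /negbTE n2]; case: ifP. Qed.

Lemma linear_total A (lt : rel T) x y : strict_linear_order_on A lt ->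
  x \in A -> y \in A -> x != y -> lt y x = ~~ lt x y.
Proof.
case=> irr trans tot xA yA neq; have := tot _ _ xA yA neq.
case xy: (lt x y) => //= _; apply/negbTE/negP=> yx.
by have := irr _ xA; rewrite (trans y x x).
Qed.

(** If [x] and [y] compared differently with the ends of [u], the edges [u] and [x y] would cross,
    and [cocomp] would give an edge between them. *)
Lemma after_edge u x y : is_edge G u -> x \in partX G -> E x y ->
  ~~ E x u.1 && ~~ E x u.2 -> ~~ E y u.1 && ~~ E y u.2 ->
  after u x = after u y.
Proof.
move=> /endsP[uX uY uE] xX xy /avoid_ends[_ xu] /avoid_ends[yu _].
have yY: y \notin partX G by rewrite (adj_side xy) xX.
rewrite /after xX (negbTE yY).
have neqx: endX u != x by apply: contraFneq xu => <-.
have neqy: y != endY u by apply: contraFneq yu => ->; rewrite adjC.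
have yP: y \in partY G by rewrite inE.
have uP: endY u \in partY G by rewrite inE.
have h1 := cocomp uX xX yP uP; have h2 := cocomp xX uX uP yP.
rewrite (linear_total linY yP uP neqy).
rewrite uE xy xu adjC yu in h1; rewrite uE xy xu (adjC _ y) yu in h2.
rewrite (linear_total linX uX xX neqx) (linear_total linY yP uP neqy) in h2.
case ux: (ltX _ _) h1 h2 => h1 h2; case yy: (ltY _ _) h1 h2 => //=.
  by move=> h _; have := h isT isT isT isT.
by move=> _ h; have := h isT isT isT isT.
Qed.

Lemma after_walk u x s : is_edge G u -> path E x s ->
  {in x :: s, forall y : T, ~~ E y u.1 && ~~ E y u.2} ->
  {in x :: s, forall y : T, after u y = after u x}.
Proof.
move=> ue; elim: s x => [|y s IHs] x /= => [_ _ w|/andP[xy ps] av w].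
  by rewrite inE => /eqP->.
rewrite inE => /predU1P[-> // | ws].
have avy: {in y :: s, forall y : T, ~~ E y u.1 && ~~ E y u.2}.
  by move=> w' w's; apply: av; rewrite inE w's orbT.
rewrite (IHs y ps avy) //.
have ax := av _ (mem_head _ _); have ay := avy _ (mem_head _ _).
case: (boolP (x \in partX G)) => xX; first by rewrite (after_edge ue xX xy).
by apply: after_edge; rewrite // 1?adjC // (adj_side xy).
Qed.

(** By [after_walk], the [X]-ends of [e_(j+k)] and [e_(j+k+1)] compare alike with that of [e_j];
    hence the comparison [s] flips when its index grows by [k]. After [2k+1] such jumps the index
    returns modulo [2k+1], after an odd number of flips. *)
Lemma linear_orders_no_asteroid k (e : 'I_k.*2.+1 -> T * T) :
  ~ weak_edge_asteroid G e.
Proof.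
case=> _ edge walk; pose f j := e (inZp j).
pose s j := ltX (endX (f j)) (endX (f (j + k))).
have addi j l : inZp (inZp (p' := k.*2) j + l) = inZp (p' := k.*2) (j + l).
  by apply: val_inj; rewrite /= modnDml.
have addp j : inZp (j + k.*2.+1) = inZp (p' := k.*2) j.
  by apply: val_inj; rewrite /= modnDr.
have endX_in u w (x : seq T) : {subset [:: u.1; u.2; w.1; w.2] <= x} ->
    endX u \in x /\ endX w \in x.
  by move=> sub; rewrite /endX; split; case: ifP => _; apply: sub; rewrite !inE eqxx ?orbT.
have s_succ j : s j = ltX (endX (f j)) (endX (f (j + (k + 1)))).
  have [x [p [px sub av]]] := walk (inZp j).
  rewrite -addnA !addi in sub; have [f1 f2] := endX_in _ _ _ sub.
  have [X1 _ _] := endsP (edge (inZp (j + k))).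
  have [X2 _ _] := endsP (edge (inZp (j + (k + 1)))).
  have a := after_walk (edge _) px av.
  by move: (a _ f1); rewrite -(a _ f2) /after X1 X2.
have s_flip j : s (j + k) = ~~ s j.
  have [x [p [px sub av]]] := walk (inZp j).
  rewrite -addnA !addi in sub; have [f1 _] := endX_in _ _ _ sub.
  have [X0 _ E0] := endsP (edge (inZp j)).
  have [X1 _ _] := endsP (edge (inZp (j + k))).
  have -> : s (j + k) = ltX (endX (f (j + k))) (endX (f j)).
    by rewrite s_succ (_ : j + k + (k + 1) = j + k.*2.+1) /f ?addp //; lia.
  apply: linear_total linX X0 X1 _.
  apply/negP=> /eqP e10; have [_] := avoid_ends (av _ f1).
  by rewrite -e10 E0.
have s_iter l j : s (j + l * k) = odd l (+) s j.
  elim: l => [|l IHl]; first by rewrite addn0.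
  by rewrite mulSn addnCA addnC s_flip IHl /= addNb.
have s_per l j : s (j + l * k.*2.+1) = s j.
  by rewrite /s /f addnAC; congr (ltX (endX (e _)) (endX (e _)));
    apply: val_inj; rewrite /= addnC modnMDl.
have := s_iter k.*2.+1 0; rewrite mulnC s_per /= odd_double.
by case: (s 0).
Qed.

End OrderObstruction.

(** * Orientations from labels *)

Section Labels.
Variable L : T * T -> nat.
Hypothesis L_forces : forall u v, forces u v -> L u = L v.
Hypothesis L_swap : forall x y, x != y -> same_side x y -> L (x, y) != L (y, x).

(** [T_free] constrains classes only, so any labelling that is constant on classes and separates
    each pair from its reverse will do. *)
Definition label_orientation := MixedGraph
  (fun x y => ~~ same_side x y && ~~ E x y)
  (fun x y => same_side x y && (L (x, y) < L (y, x))).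

Lemma label_orientation_complement : orientation_of_complement G label_orientation.
Proof.
split=> //= [x y /andP[/eqP s lt] | x y neq s]; last first.
  rewrite /same_side s eqxx /=.
  by have := L_swap neq; rewrite /same_side s eqxx => /(_ isT); case: ltngtP.
by split=> //; apply: contraTneq lt => ->; rewrite ltnn.
Qed.

(** In the forbidden configuration [(x, x')] forces [(y', y)], so the arc [x -> x'] comes with the
    arc [y' -> y]. *)
Lemma label_orientation_T_free : T_free G label_orientation.
Proof.
case=> x [x' [y [y' [_ [nxy nx'y'] [xy' x'y] /= [/andP[_ lx] /andP[_ ly]]]]]].
have f: forces (x, x') (y', y) by apply/and4P.
have f': forces (x', x) (y, y') by apply/and4P.
by move: lx; rewrite (L_forces f) (L_forces f') ltnNge ltnW.
Qed.

End Labels.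

(** * From an invertible pair to a weak edge-asteroid *)

Section InvertiblePair.
Variables (k : nat) (P : nat -> T * T).
Hypothesis P_forces : forall i, i <= k -> forces (P i) (P i.+1).
Hypothesis P_swap : P k.+1 = swap (P 0).
Hypothesis P_side : same_side (P 0).1 (P 0).2.

(** The chain is continued by its own reverse: a shift by [k+1] swaps the components, and [2k+2] is
    a period. *)
Definition unroll i :=
  let u := P (i %% k.+1) in if odd (i %/ k.+1) then swap u else u.

Definition closed_walk i := (unroll i).1.

Local Notation W := closed_walk.

Definition invertible_pair_edges (i : 'I_k.*2.+1) := (W i, W i.+1).

Lemma unroll_swap i : unroll (i + k.+1) = swap (unroll i).
Proof.
rewrite /unroll modnDr divnDr // divnn /= addn1 /=.
by case: odd; rewrite ?swapK.
Qed.

Lemma unroll_forces i : forces (unroll i) (unroll i.+1).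
Proof.
have lt_r := ltn_pmod i (ltn0Sn k).
have -> : unroll i.+1 =
    if odd (i %/ k.+1) then swap (P (i %% k.+1).+1) else P (i %% k.+1).+1.
  rewrite [in LHS](divn_eq i k.+1) -addnS; move: (i %/ k.+1) (i %% k.+1) lt_r => d r.
  rewrite ltnS leq_eqVlt => /predU1P[-> | lt].
    rewrite -mulSnr /unroll modnMl mulnK // P_swap /=.
    by case: odd; rewrite ?swapK.
  by rewrite /unroll modnMDl divnMDl // modn_small // divn_small // addn0.
by rewrite /unroll; case: odd; rewrite ?forces_swap P_forces // -ltnS.
Qed.

Lemma unroll_side i : same_side (unroll i).1 (unroll i).2.
Proof.
elim: i => [|i IHi]; last exact: forces_same_side (unroll_forces i) IHi.
by rewrite /unroll mod0n div0n.
Qed.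

Lemma closed_walk_snd i : W (i + k.+1) = (unroll i).2.
Proof. by rewrite /closed_walk unroll_swap. Qed.

Lemma closed_walk_per i : W (i + k.+1.*2) = W i.
Proof. by rewrite -addnn addnA closed_walk_snd unroll_swap. Qed.

Lemma closed_walk_edge i : E (W i) (W i.+1).
Proof. by case/and4P: (unroll_forces i). Qed.

Lemma closed_walk_nadj i :
  (E (W i) (W (i.+1 + k.+1)) = false) * (E (W i.+1) (W (i + k.+1)) = false).
Proof.
case/and4P: (unroll_forces i) => _ _ /negbTE n1 /negbTE n2.
by rewrite !closed_walk_snd n1 adjC n2.
Qed.

Lemma closed_walk_nadj0 i : E (W i) (W (i + k.+1)) = false.
Proof. by apply: same_side_nadj; rewrite closed_walk_snd unroll_side. Qed.

Lemma closed_walk_side2 i : same_side (W i) (W i.+2).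
Proof.
rewrite /same_side (adj_side (closed_walk_edge i.+1)).
by rewrite (adj_side (closed_walk_edge i)) negbK.
Qed.

(** For [k = 0] the pair would force its reverse, making two vertices of one side adjacent. *)
Lemma invertible_pair_gt0 : 0 < k.
Proof.
rewrite lt0n; apply/negP=> /eqP k0.
have := P_forces (leq0n k); move: P_swap; rewrite k0 => -> /and4P[] /=.
by rewrite (same_side_nadj P_side).
Qed.

(** Antipodal vertices of the closed walk lie on one side. Of the eight vertex pairs concerned, four
    lie on one side by parity and four are the non-edges of forcings. *)
Lemma invertible_pair_avoid i :
  {in [:: W (i + k); W (i + k.+1); W (i.+1 + k.+1); W (i.+2 + k.+1)],
    forall y : T, ~~ E y (W i) && ~~ E y (W i.+1)}.
Proof.
have side j l : same_side (W j) (W l) -> E (W j) (W l) = false.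
  exact: same_side_nadj.
have side0 j : (W (j + k.+1) \in partX G) = (W j \in partX G).
  by rewrite closed_walk_snd -(eqP (unroll_side j)).
have side2 j := esym (eqP (closed_walk_side2 j)).
move=> y; rewrite !inE => /or4P[]/eqP->; apply/andP; split; apply/negbT.
- have := (closed_walk_nadj (i + k)).1.
  by rewrite (_ : (i + k).+1 + k.+1 = i + k.+1.*2) ?closed_walk_per //; lia.
- apply: side; rewrite /same_side -(side0 i.+1) addSnnS -side2.
  by rewrite addnS addnS.
- by rewrite adjC closed_walk_nadj0.
- by rewrite adjC (closed_walk_nadj i).2.
- by rewrite adjC (closed_walk_nadj i).1.
- by rewrite adjC closed_walk_nadj0.
- by apply: side; rewrite /same_side -(side0 i) !addSn side2.
- by rewrite adjC (closed_walk_nadj i.+1).1.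
Qed.

(* [W_i W_(i+1)] avoids the walk [W_(i+k) ... W_(i+k+3)], hence the edges with
   indices [i+k], [i+k+1] and [i+k+2]; dropping the last of the [2k+2] edges of
   the closed walk shifts indices by at most one. *)
Lemma invertible_pair_asteroid : weak_edge_asteroid G invertible_pair_edges.
Proof.
have k0 := invertible_pair_gt0; split=> // [i|i]; first exact: closed_walk_edge.
exists (W (i + k)), [:: W (i + k.+1); W (i.+1 + k.+1); W (i.+2 + k.+1)].
split; last exact: invertible_pair_avoid.
  by rewrite /= -!addSnnS /= !addSn !closed_walk_edge.
have per j l : l = j + k.+1.*2 -> W l = W j by move=> ->; exact: closed_walk_per.
have lt_i := ltn_ord i; rewrite /invertible_pair_edges /=.
have mod_wrap j : k.*2.+1 <= j -> j < k.*2.+1.*2 -> j %% k.*2.+1 = j - k.*2.+1.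
  by move=> le lt; rewrite -[in LHS](subnK le) modnDr modn_small //; lia.
(* The walk has period [2k+2] while indices are reduced modulo [2k+1]: a wrapped index
   [i + k - (2k+1)] denotes the same place as [i + k + 1]. *)
have e1 : let r := (i + k) %% k.*2.+1 in (W r, W r.+1) \in
    [:: (W (i + k), W (i + k.+1)); (W (i + k.+1), W (i.+1 + k.+1))].
  case: (ltnP (i + k) k.*2.+1) => [lt|le] /=.
    by rewrite modn_small // addnS mem_head.
  rewrite mod_wrap //; last by lia.
  rewrite -(per (i + k - k.*2.+1) (i + k.+1)); last by lia.
  rewrite -(per (i + k - k.*2.+1).+1 (i.+1 + k.+1)); last by lia.
  by rewrite !inE eqxx orbT.
have e2 : let r := (i + k + 1) %% k.*2.+1 in (W r, W r.+1) \in
    [:: (W (i + k.+1), W (i.+1 + k.+1)); (W (i.+1 + k.+1), W (i.+2 + k.+1))].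
  rewrite addn1 -addnS; case: (ltnP (i + k.+1) k.*2.+1) => [lt|le] /=.
    by rewrite modn_small // mem_head.
  rewrite mod_wrap //; last by lia.
  rewrite -(per (i + k.+1 - k.*2.+1) (i.+1 + k.+1)); last by lia.
  rewrite -(per (i + k.+1 - k.*2.+1).+1 (i.+2 + k.+1)); last by lia.
  by rewrite !inE eqxx orbT.
move=> y; move: e1 e2 => /=; rewrite !inE !xpair_eqE.
by case/orP=> /andP[/eqP-> /eqP->] /orP[]/andP[/eqP-> /eqP->] /or4P[]/eqP->;
  rewrite eqxx ?orbT.
Qed.

End InvertiblePair.

End Forcing.

(** * A loop language compiled to random-access machines *)

(* [EScale e] is [n * e] and [EFind x d e] is [i + 1] for the last [i < n ^ d]
   such that [e] does not vanish at [x := i], or 0 if there is none.  Loops of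
   statements also range over [i < n ^ d], which makes every running time a
   polynomial in [n] by construction. *)
Inductive expr : Type :=
| EConst (c : nat)
| EVar (x : nat)
| EDim
| EAdd (a b : expr)
| ESub (a b : expr)
| EScale (a : expr)
| ELoad (a : expr)
| EIf (c a b : expr)
| EFind (x d : nat) (a : expr).

Inductive stmt : Type :=
| SSkip
| SStore (a b : expr)
| SSeq (p q : stmt)
| SIf (c : expr) (p q : stmt)
| SFor (x d : nat) (p : stmt)
| SLet (x : nat) (a : expr) (p : stmt).

Fixpoint eval (n : nat) (m v : nat -> nat) (e : expr) : nat :=
  match e with
  | EConst c => c
  | EVar x => v x
  | EDim => n
  | EAdd a b => eval n m v a + eval n m v b
  | ESub a b => eval n m v a - eval n m v b
  | EScale a => n * eval n m v a
  | ELoad a => m (eval n m v a)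
  | EIf c a b => if eval n m v c != 0 then eval n m v a else eval n m v b
  | EFind x d a =>
      foldl (fun r i => if eval n m (update v x i) a != 0 then i.+1 else r)
        0 (iota 0 (n ^ d))
  end.

Fixpoint run (n : nat) (v : nat -> nat) (p : stmt) (m : nat -> nat) : nat -> nat :=
  match p with
  | SSkip => m
  | SStore a b => update m (eval n m v a) (eval n m v b)
  | SSeq p q => run n v q (run n v p m)
  | SIf c p q => if eval n m v c != 0 then run n v p m else run n v q m
  | SFor x d p => foldl (fun m i => run n (update v x i) p m) m (iota 0 (n ^ d))
  | SLet x a p => run n (update v x (eval n m v a)) p m
  end.

Local Notation memory := Defs.mem.

(* Register 0 holds [n], odd registers hold variables, and the other even
   registers form a stack of temporaries. *)
Definition vreg x := x.*2.+1.
Definition treg k := k.*2.+2.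

Definition copy r a := Seq (Const r 0) (Add r r a).

(** Multiplication by repeated addition: [treg k.+1] accumulates, [treg k.+2] counts down from [n],
    and [treg k.+3] holds 1. *)
Definition scale k :=
  Seq (copy (treg k.+2) 0)
  (Seq (Const (treg k.+1) 0)
  (Seq (Const (treg k.+3) 1)
  (Seq (While (treg k.+2)
         (Seq (Add (treg k.+1) (treg k.+1) (treg k))
              (Defs.Sub (treg k.+2) (treg k.+2) (treg k.+3))))
       (copy (treg k) (treg k.+1))))).

Fixpoint power k d :=
  if d is d'.+1 then Seq (power k d') (scale k) else Const (treg k) 1.

(** [treg k] counts the remaining rounds, [treg k.+1] holds the index, [treg k.+2] the constant 1,
    and [treg k.+3] the outer value of the loop variable, restored at the end. The body must leave
    these four intact. *)
Definition loop k x d body :=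
  Seq (power k d)
  (Seq (Const (treg k.+1) 0)
  (Seq (Const (treg k.+2) 1)
  (Seq (copy (treg k.+3) (vreg x))
  (Seq (While (treg k)
         (Seq (copy (vreg x) (treg k.+1))
         (Seq body
         (Seq (Add (treg k.+1) (treg k.+1) (treg k.+2))
              (Defs.Sub (treg k) (treg k) (treg k.+2))))))
       (copy (vreg x) (treg k.+3)))))).

(** The value ends up in [treg k]. In a search, [treg k.+2] and [treg k.+3] are the index and the
    constant 1 of the loop, so their sum is [i + 1]. *)
Fixpoint cexpr k e : program :=
  match e with
  | EConst c => Const (treg k) c
  | EVar x => copy (treg k) (vreg x)
  | EDim => copy (treg k) 0
  | EAdd a b =>
      Seq (cexpr k a) (Seq (cexpr k.+1 b) (Add (treg k) (treg k) (treg k.+1)))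
  | ESub a b =>
      Seq (cexpr k a) (Seq (cexpr k.+1 b) (Defs.Sub (treg k) (treg k) (treg k.+1)))
  | EScale a => Seq (cexpr k a) (scale k)
  | ELoad a => Seq (cexpr k a) (Read (treg k) (treg k))
  | EIf c a b => Seq (cexpr k c) (If (treg k) (cexpr k a) (cexpr k b))
  | EFind x d a =>
      Seq (Const (treg k) 0)
        (loop k.+1 x d
          (Seq (cexpr k.+4.+1 a)
            (If (treg k.+4.+1)
               (Add (treg k) (treg k.+2) (treg k.+3)) Skip)))
  end.

Fixpoint cstmt k p : program :=
  match p with
  | SSkip => Skip
  | SStore a b =>
      Seq (cexpr k a) (Seq (cexpr k.+1 b) (Write (treg k) (treg k.+1)))
  | SSeq p q => Seq (cstmt k p) (cstmt k q)
  | SIf c p q => Seq (cexpr k c) (If (treg k) (cstmt k p) (cstmt k q))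
  | SFor x d p => loop k x d (cstmt k.+4 p)
  | SLet x a p =>
      Seq (cexpr k a)
      (Seq (copy (treg k.+1) (vreg x))
      (Seq (copy (vreg x) (treg k))
      (Seq (cstmt k.+2 p) (copy (vreg x) (treg k.+1)))))
  end.

(** Register 0 starts at 0, so the first instruction loads [n] from cell 0. *)
Definition compile p := Seq (Read 0 0) (cstmt 0 p).

Definition scale_cost n := (n * 3).+1 + 6.

Definition power_cost n d := (d * scale_cost n).+1.

(** Each round costs [c] for the body, 4 for bookkeeping and 1 for the test; the last test adds 1,
    and the instructions around the loop 6. *)
Definition loop_cost n d c := power_cost n d + (n ^ d * c.+4.+1).+1 + 6.

Fixpoint ecost n e : nat :=
  match e with
  | EConst _ => 1
  | EVar _ | EDim => 2
  | EAdd a b | ESub a b => ecost n a + ecost n b + 1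
  | EScale a => ecost n a + scale_cost n
  | ELoad a => ecost n a + 1
  | EIf c a b => ecost n c + (ecost n a + ecost n b).+1
  | EFind x d a => (loop_cost n d (ecost n a + 3)).+1
  end.

Fixpoint scost n p : nat :=
  match p with
  | SSkip => 1
  | SStore a b => ecost n a + ecost n b + 1
  | SSeq p q => scost n p + scost n q
  | SIf c p q => ecost n c + (scost n p + scost n q).+1
  | SFor x d p => loop_cost n d (scost n p)
  | SLet x a p => ecost n a + scost n p + 6
  end.

(** * Total-correctness triples with time bounds *)

Definition ok p s c (Q : state -> Prop) :=
  exists t s', [/\ exec p s t s', t <= c & Q s'].

Lemma ok_weaken p s c c' (Q Q' : state -> Prop) :
  ok p s c Q -> c <= c' -> (forall s', Q s' -> Q' s') -> ok p s c' Q'.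
Proof.
move=> [t [s' [ex le q]]] cc' QQ'; exists t, s'; split=> //; last exact: QQ'.
exact: leq_trans le cc'.
Qed.

Lemma ok_skip s (Q : state -> Prop) : Q s -> ok Skip s 1 Q.
Proof. by exists 1, s; split=> //; constructor. Qed.

Lemma ok_const r c s (Q : state -> Prop) :
  Q (set_reg s r c) -> ok (Const r c) s 1 Q.
Proof. by exists 1, (set_reg s r c); split=> //; constructor. Qed.

Lemma ok_add r a b s (Q : state -> Prop) :
  Q (set_reg s r (reg s a + reg s b)) -> ok (Add r a b) s 1 Q.
Proof. by eexists 1, _; split; first constructor. Qed.

Lemma ok_sub r a b s (Q : state -> Prop) :
  Q (set_reg s r (reg s a - reg s b)) -> ok (Defs.Sub r a b) s 1 Q.
Proof. by eexists 1, _; split; first constructor. Qed.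

Lemma ok_read r a s (Q : state -> Prop) :
  Q (set_reg s r (memory s (reg s a))) -> ok (Read r a) s 1 Q.
Proof. by eexists 1, _; split; first constructor. Qed.

Lemma ok_write a r s (Q : state -> Prop) :
  Q (set_mem s (reg s a) (reg s r)) -> ok (Write a r) s 1 Q.
Proof. by eexists 1, _; split; first constructor. Qed.

Lemma ok_seq p q s c1 c2 c (P Q : state -> Prop) :
  ok p s c1 P -> (forall s', P s' -> ok q s' c2 Q) -> c1 + c2 <= c ->
  ok (Seq p q) s c Q.
Proof.
move=> [t1 [s1 [e1 le1 h1]]] /(_ _ h1)[t2 [s2 [e2 le2 h2]]] lec.
by exists (t1 + t2), s2; split=> //; [apply: exec_seq e1 e2 | lia].
Qed.

Lemma ok_step p q s t s1 c2 c (Q : state -> Prop) :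
  exec p s t s1 -> t + c2 <= c -> ok q s1 c2 Q -> ok (Seq p q) s c Q.
Proof.
move=> e1 lec [t2 [s2 [e2 le2 h2]]].
by exists (t + t2), s2; split=> //; [apply: exec_seq e1 e2 | lia].
Qed.

Lemma exec_copy r a s : r != a ->
  exec (copy r a) s 2 (set_reg (set_reg s r 0) r (reg s a)).
Proof.
move=> ra; rewrite -[X in exec _ _ X _]/(1 + 1).
apply: exec_seq (exec_const _ _ _) _.
have -> : reg s a = reg (set_reg s r 0) r + reg (set_reg s r 0) a.
  by rewrite /= /update eqxx eq_sym (negbTE ra).
exact: exec_add.
Qed.

Lemma ok_copy r a s (Q : state -> Prop) : r != a ->
  Q (set_reg (set_reg s r 0) r (reg s a)) -> ok (copy r a) s 2 Q.
Proof. by move=> /(exec_copy s); eexists; eexists; split; eauto. Qed.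

Lemma ok_if r p q s c1 c2 (Q : state -> Prop) :
  (reg s r != 0 -> ok p s c1 Q) -> (reg s r = 0 -> ok q s c2 Q) ->
  ok (If r p q) s (c1 + c2).+1 Q.
Proof.
move=> h1 h2; have [r0|r0] := eqVneq (reg s r) 0.
  have [t [s' [ex le h]]] := h2 r0.
  by exists t.+1, s'; split=> //; [apply: exec_if_false | lia].
have [t [s' [ex le h]]] := h1 r0.
by exists t.+1, s'; split=> //; [apply: exec_if_true | lia].
Qed.

(** The invariant is indexed by the value of the loop register, which counts down. *)
Lemma ok_while r p c (I : nat -> state -> Prop) N s :
  (forall i s, I i s -> reg s r = i) ->
  (forall i s, i < N -> I i.+1 s -> ok p s c (I i)) ->
  I N s -> ok (While r p) s (N * c.+1).+1 (I 0).
Proof.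
move=> Ir; elim: N s => [|N IHN] s body IN.
  by exists 1, s; split=> //; apply/exec_while_false/Ir.
have [t1 [s1 [e1 le1 h1]]] := body N s (ltnSn N) IN.
have [//|t2 [s2 [e2 le2 h2]]] := IHN s1 _ h1.
  by move=> i s' lt; apply: body; rewrite ltnS ltnW.
exists (t1 + t2).+1, s2; split=> //; last by nia.
by apply: exec_while_true e1 e2; rewrite (Ir _ _ IN).
Qed.

Definition sim n v s := reg s 0 = n /\ forall x, reg s (vreg x) = v x.

Definition kept k s s' := forall j, j < k -> reg s' (treg j) = reg s (treg j).

Ltac regs := unfold treg, vreg in *; rewrite /= /update;
  repeat (case: eqP => [?|?]); try lia; try congruence.

Lemma ok_scale n v k s : sim n v s ->
  ok (scale k) s (scale_cost n) (fun s' => [/\ sim n v s', kept k s s',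
    reg s' (treg k) = n * reg s (treg k) & memory s' = memory s]).
Proof.
move=> [s0 sv].
apply: (@ok_step _ _ _ _ _ ((n * 3).+1 + 4) _ _ (exec_copy _ _));
  [by regs | by rewrite ?/scale_cost; lia |].
apply: (@ok_step _ _ _ _ _ ((n * 3).+1 + 3) _ _ (exec_const _ _ _));
  [by rewrite ?/scale_cost; lia |].
apply: (@ok_step _ _ _ _ _ ((n * 3).+1 + 2) _ _ (exec_const _ _ _)); [by lia |].
pose I i s' := [/\ sim n v s', kept k.+1 s s', memory s' = memory s &
  [/\ reg s' (treg k.+2) = i, reg s' (treg k.+3) = 1
    & i <= n /\ reg s' (treg k.+1) = (n - i) * reg s (treg k)]].
apply: (@ok_seq _ _ _ (n * 3).+1 2 _ (I 0)) => [||//].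
- apply: ok_while => [i s' [_ _ _ []] // | i s' lt_i [[s0' sv'] ks' ms' [r2 r3 [le r1]]] |].
    apply: (@ok_step _ _ _ _ _ 1 _ _ (exec_add _ _ _ _));
      [by rewrite ?/scale_cost; lia |].
    apply: ok_sub; split=> //.
    + by split=> [|x]; rewrite -?s0' -?sv'; regs.
    + by move=> j lt; rewrite -ks' //; regs.
    split; first by regs.
      by rewrite -r3; regs.
    split; first by lia.
    have -> : n - i = (n - i.+1).+1 by lia.
    by rewrite mulSn addnC -r1 -ks' //; regs.
  split=> //.
  + by split=> [|x]; rewrite -?s0 -?sv; regs.
  + by move=> j lt; regs.
  split; first by rewrite -[in RHS]s0; regs.
    by regs.
  by rewrite subnn; split=> //; regs.
move=> s' [[s0' sv'] ks' ms' [_ _ [_ r1]]]; apply: ok_copy; first by regs.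
split=> //.
- by split=> [|x]; rewrite -?s0' -?sv'; regs.
- by move=> j lt; rewrite -ks' ?leqW //; regs.
by rewrite subn0 in r1; rewrite -r1; regs.
Qed.

Lemma ok_power n v k d s : sim n v s ->
  ok (power k d) s (power_cost n d) (fun s' => [/\ sim n v s', kept k s s',
    reg s' (treg k) = n ^ d & memory s' = memory s]).
Proof.
elim: d s => [|d IHd] s [s0 sv] /=.
  apply: ok_const; split=> //; last by regs.
    by split=> [|x]; rewrite -?s0 -?sv; regs.
  by move=> j lt; regs.
apply: (ok_seq (c2 := scale_cost n) (IHd s (conj s0 sv))) => [s' [sim' ks' r' m']|]; last first.
  by rewrite /power_cost mulSn; lia.
apply: ok_weaken (ok_scale k sim') (leqnn _) _ => s2 [sim2 ks2 r2 m2].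
split=> //; [by move=> j lt; rewrite ks2 // ks' | by rewrite r2 r' expnS | by rewrite m2].
Qed.

(** [I] may depend only on the memory and the temporaries below [k], so the bookkeeping of the loop
    preserves it. *)
Lemma ok_loop n v k x d body c s (I : nat -> state -> Prop) :
  sim n v s ->
  (forall i s1 s2, memory s2 = memory s1 -> kept k s1 s2 -> I i s1 -> I i s2) ->
  (forall i s1, i < n ^ d -> sim n (update v x i) s1 -> I i s1 ->
     reg s1 (treg k.+1) = i -> reg s1 (treg k.+2) = 1 ->
     ok body s1 c (fun s2 => [/\ sim n (update v x i) s2,
       forall j, k <= j < k.+4 -> reg s2 (treg j) = reg s1 (treg j) & I i.+1 s2])) ->
  I 0 s ->
  ok (loop k x d body) s (loop_cost n d c) (fun s' => sim n v s' /\ I (n ^ d) s').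
Proof.
move=> sim_s Istab step I0; set N := n ^ d.
apply: (@ok_seq _ _ _ (power_cost n d) ((N * c.+4.+1).+1 + 6) _ _ _
  (ok_power k d sim_s)) => [s1|]; last first.
  by rewrite /loop_cost; lia.
move=> [[s10 s1v] ks1 r1 m1].
apply: (@ok_step _ _ _ _ _ ((N * c.+4.+1).+1 + 5) _ _ (exec_const _ _ _));
  [by rewrite ?/scale_cost; lia |].
apply: (@ok_step _ _ _ _ _ ((N * c.+4.+1).+1 + 4) _ _ (exec_const _ _ _));
  [by rewrite ?/scale_cost; lia |].
apply: (@ok_step _ _ _ _ _ ((N * c.+4.+1).+1 + 2) _ _ (exec_copy _ _));
  [by regs | by lia |].
(* [J] counts down with the loop register, while [I] counts the rounds completed. *)
pose J i s' := [/\ i <= N, reg s' 0 = n, forall y, y != x -> reg s' (vreg y) = v y,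
    I (N - i) s'
  & [/\ reg s' (treg k) = i, reg s' (treg k.+1) = N - i, reg s' (treg k.+2) = 1
     & reg s' (treg k.+3) = v x]].
apply: (@ok_seq _ _ _ (N * c.+4.+1).+1 2 _ (J 0)) => [||//].
- apply: ok_while => [i s' [_ _ _ _ []] // | i s' lt_i |].
    move=> [le s'0 s'v Ii [q0 q1 q2 q3]].
    apply: (@ok_step _ _ _ _ _ (c + 2) _ _ (exec_copy _ _));
      [by regs | by rewrite ?/scale_cost; lia |].
    pose i' := N - i.+1; have lt_i' : i' < N by rewrite /i'; lia.
    apply: (@ok_seq _ _ _ c 2) => [||//].
      apply: (step i') => //.
      + split=> [|y]; first by rewrite -s'0; regs.
        have [->|yx] := eqVneq y x; first by rewrite /= /update !eqxx.
        by rewrite /update (negbTE yx) -s'v //; move: yx => /eqP yx; regs.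
      + by apply: Istab Ii => // j lt; regs.
      + by rewrite /i' -q1; regs.
      + by rewrite -q2; regs.
    move=> s2 [[s20 s2v] ks2 I2].
    have keep j : k <= j < k.+4 -> reg s2 (treg j) = reg s' (treg j).
      by move=> lt; rewrite ks2 //; regs.
    apply: (@ok_step _ _ _ _ _ 1 _ _ (exec_add _ _ _ _));
      [by rewrite ?/scale_cost; lia |].
    apply: ok_sub; split; first exact: ltnW.
    + by rewrite -s20; regs.
    + move=> y yx; have := s2v y; rewrite /update (negbTE yx) => <-.
      by regs.
    + rewrite (_ : N - i = i'.+1); last by rewrite /i'; lia.
      by apply: Istab I2 => // j lt; regs.
    split; first by have := keep k; have := keep k.+2; regs.
    + rewrite (_ : N - i = i' + 1); last by rewrite /i'; lia.
      by rewrite /i' -q1 -q2 -!keep; try lia; regs.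
    + by rewrite -q2 -keep; try lia; regs.
    by rewrite -q3 -keep; try lia; regs.
  split=> //.
  + by move=> y yx; rewrite -s1v; regs.
  + rewrite subnn; apply: Istab I0; first by rewrite -m1.
    by move=> j lt; rewrite -ks1 //; regs.
  split; [by rewrite /N -r1; regs | by rewrite subnn; regs | by regs | by rewrite -s1v; regs].
move=> s' [_ s'0 s'v Ii [q0 q1 q2 q3]]; apply: ok_copy; first by regs.
split; last by rewrite subn0 in Ii; apply: Istab Ii => // j lt; regs.
split=> [|y]; first by rewrite -s'0; regs.
have [->|yx] := eqVneq y x; first by rewrite /= /update eqxx q3.
by rewrite -s'v //; move: yx => /eqP yx; regs.
Qed.

Lemma iota0S i : iota 0 i.+1 = rcons (iota 0 i) i.
Proof. by rewrite -addn1 iotaD cats1. Qed.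

Lemma ok_expr n v k e s : sim n v s ->
  ok (cexpr k e) s (ecost n e) (fun s' => [/\ sim n v s', kept k s s',
    reg s' (treg k) = eval n (memory s) v e & memory s' = memory s]).
Proof.
elim: e v k s => [c|x||a IHa b IHb|a IHa b IHb|a IHa|a IHa|c IHc a IHa b IHb
  |x d a IHa] v k s sim_s /=.
- case: sim_s => s0 sv; apply: ok_const; split=> //; last by regs.
    by split=> [|y]; rewrite -?s0 -?sv; regs.
  by move=> j lt; regs.
- case: sim_s => s0 sv; apply: ok_copy; first by regs.
  split=> //; last by rewrite -sv; regs.
    by split=> [|y]; rewrite -?s0 -?sv; regs.
  by move=> j lt; regs.
- case: sim_s => s0 sv; apply: ok_copy; first by regs.
  split=> //; last by rewrite -[RHS]s0; regs.
    by split=> [|y]; rewrite -?s0 -?sv; regs.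
  by move=> j lt; regs.
- apply: (ok_seq (c2 := ecost n b + 1) (IHa v k s sim_s)) => [s1 [sim1 k1 r1 m1]|]; last first.
    by rewrite addnA.
  apply: (ok_seq (IHb v k.+1 s1 sim1)) (leqnn _) => s2 [[s20 s2v] k2 r2 m2].
  apply: ok_add; rewrite /= k2 // r1 r2 m1; split=> //; last by rewrite -m1.
  + by split=> [|y]; rewrite -?s20 -?s2v; regs.
  + by move=> j lt; rewrite -k1 // -k2 1?ltnW //; regs.
  by rewrite /update eqxx.
- apply: (ok_seq (c2 := ecost n b + 1) (IHa v k s sim_s)) => [s1 [sim1 k1 r1 m1]|]; last first.
    by rewrite addnA.
  apply: (ok_seq (IHb v k.+1 s1 sim1)) (leqnn _) => s2 [[s20 s2v] k2 r2 m2].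
  apply: ok_sub; rewrite /= k2 // r1 r2 m1; split=> //; last by rewrite -m1.
  + by split=> [|y]; rewrite -?s20 -?s2v; regs.
  + by move=> j lt; rewrite -k1 // -k2 1?ltnW //; regs.
  by rewrite /update eqxx.
- apply: (ok_seq (IHa v k s sim_s)) (leqnn _) => s1 [sim1 k1 r1 m1].
  apply: ok_weaken (ok_scale k sim1) (leqnn _) _ => s2 [sim2 k2 r2 m2].
  split=> //; last by rewrite m2.
    by move=> j lt; rewrite k2 // k1.
  by rewrite r2 r1.
- apply: (ok_seq (IHa v k s sim_s)) (leqnn _) => s1 [[s10 s1v] k1 r1 m1].
  apply: ok_read; split=> //.
  + by split=> [|y]; rewrite -?s10 -?s1v; regs.
  + by move=> j lt; rewrite -k1 //; regs.
  by rewrite /= /update eqxx r1 m1.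
- apply: (ok_seq (IHc v k s sim_s)) (leqnn _) => s1 [sim1 k1 r1 m1].
  apply: ok_if; rewrite r1 => c0; rewrite ?c0 /=.
    apply: ok_weaken (IHa v k s1 sim1) (leqnn _) _ => s2 [sim2 k2 r2 m2].
    by rewrite r2 m2 m1; split=> // j lt; rewrite k2 // k1.
  apply: ok_weaken (IHb v k s1 sim1) (leqnn _) _ => s2 [sim2 k2 r2 m2].
  by rewrite r2 m2 m1; split=> // j lt; rewrite k2 // k1.
case: (sim_s) => s0 sv.
apply: (@ok_step _ _ _ _ _ (loop_cost n d (ecost n a + 3)) _ _ (exec_const _ _ _)) => //.
pose F i := foldl (fun r i => if eval n (memory s) (update v x i) a != 0 then i.+1 else r)
  0 (iota 0 i).
pose I i s' := [/\ memory s' = memory s, kept k s s' & reg s' (treg k) = F i].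
apply: ok_weaken (@ok_loop n v k.+1 x d _ (ecost n a + 3) _ I _ _ _ _) (leqnn _) _ => //.
- by split=> [|y]; rewrite -?s0 -?sv; regs.
- move=> i s1 s2 m21 k21 [m1 k1 r1]; split; first by rewrite m21.
    by move=> j lt; rewrite k21 ?k1 // ltnW.
  by rewrite k21 // r1.
- move=> i s1 _ sim1 [m1 k1 r1] q1 q2.
  apply: (ok_seq (IHa (update v x i) k.+4.+1 s1 sim1)) (leqnn _) => s2 [[s20 s2v] k2 r2 m2].
  apply: (@ok_if _ _ _ _ 1 1) => c0.
    apply: ok_add; split=> //.
    + by split=> [|y]; rewrite -?s20 -?s2v; regs.
    + by move=> j lt; rewrite -k2; [regs | lia].
    split; [by rewrite -m1 | by move=> j lt; rewrite -k1 // -k2; [regs | lia] |].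
    rewrite /F iota0S foldl_rcons /= /update eqxx !k2; try lia.
    by rewrite q1 q2 -m1 -r2 c0 addn1.
  apply: ok_skip; split=> //.
    by move=> j lt; rewrite k2 //; lia.
  split; [by rewrite m2 | by move=> j lt; rewrite k2 ?k1 //; lia |].
  by rewrite k2 ?r1 /F; [rewrite iota0S foldl_rcons -/(F i) -m1 -r2 c0 | lia].
- split=> //; last by regs.
  by move=> j lt; regs.
by move=> s' [sim' [m' k' r']]; split.
Qed.

Lemma ok_stmt n v k p s : sim n v s ->
  ok (cstmt k p) s (scost n p) (fun s' => [/\ sim n v s', kept k s s'
    & memory s' = run n v p (memory s)]).
Proof.
elim: p v k s => [|a b|p IHp q IHq|c p IHp q IHq|x d p IHp|x a p IHp] v k s sim_s /=.
- exact: ok_skip.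
- apply: (ok_seq (c2 := ecost n b + 1) (ok_expr k a sim_s)) => [s1 [sim1 k1 r1 m1]|]; last first.
    by rewrite addnA.
  apply: (ok_seq (ok_expr k.+1 b sim1)) (leqnn _) => s2 [sim2 k2 r2 m2].
  apply: ok_write; split=> //; first by move=> j lt; rewrite -k1 // -k2 // ltnW.
  by rewrite /= k2 // r1 r2 m2 m1.
- apply: (ok_seq (IHp v k s sim_s)) (leqnn _) => s1 [sim1 k1 m1].
  apply: ok_weaken (IHq v k s1 sim1) (leqnn _) _ => s2 [sim2 k2 m2].
  by rewrite m2 m1; split=> // j lt; rewrite k2 ?k1.
- apply: (ok_seq (ok_expr k c sim_s)) (leqnn _) => s1 [sim1 k1 r1 m1].
  apply: ok_if; rewrite r1 => c0; rewrite ?c0 /= -m1.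
    apply: ok_weaken (IHp v k s1 sim1) (leqnn _) _ => s2 [sim2 k2 m2].
    by split=> // j lt; rewrite k2 ?k1.
  apply: ok_weaken (IHq v k s1 sim1) (leqnn _) _ => s2 [sim2 k2 m2].
  by split=> // j lt; rewrite k2 ?k1.
- pose F i := foldl (fun m i => run n (update v x i) p m) (memory s) (iota 0 i).
  pose I i s' := kept k s s' /\ memory s' = F i.
  apply: ok_weaken (@ok_loop n v k x d _ (scost n p) _ I _ _ _ _) (leqnn _) _ => //.
  + move=> i s1 s2 m21 k21 [k1 m1]; split; last by rewrite m21.
    by move=> j lt; rewrite k21 ?k1.
  + move=> i s1 _ sim1 [k1 m1] _ _.
    apply: ok_weaken (IHp _ k.+4 s1 sim1) (leqnn _) _ => s2 [sim2 k2 m2].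
    split=> //; first by move=> j lt; rewrite k2 //; lia.
    split; first by move=> j lt; rewrite k2 ?k1 //; lia.
    by rewrite m2 m1 /F iota0S foldl_rcons.
  by move=> s' [sim' [k' m']].
set w := eval n _ v a.
apply: (ok_seq (c2 := scost n p + 6) (ok_expr k a sim_s)) => [s1 [[s10 s1v] k1 r1 m1]|]; last by lia.
apply: (@ok_step _ _ _ _ _ (scost n p + 4) _ _ (exec_copy _ _)); [by regs | by lia |].
apply: (@ok_step _ _ _ _ _ (scost n p + 2) _ _ (exec_copy _ _)); [by regs | by lia |].
apply: (@ok_seq _ _ _ (scost n p) 2) => [||//].
  apply: (IHp (update v x w)); split=> [|y]; first by rewrite -s10; regs.
  have [->|yx] := eqVneq y x; first by rewrite /update eqxx /w -r1; regs.
  by rewrite /update (negbTE yx) -s1v //; move: yx => /eqP yx; regs.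
move=> s2 [[s20 s2v] k2 m2]; apply: ok_copy; first by regs.
have r2 : reg s2 (treg k.+1) = v x by rewrite k2 // -s1v; regs.
split; last by rewrite /= m2 -m1.
  split=> [|y]; first by rewrite -s20; regs.
  have [->|yx] := eqVneq y x; first by rewrite /= /update eqxx.
  by have := s2v y; rewrite /update (negbTE yx) => <-; move: yx => /eqP yx; regs.
by move=> j lt; rewrite -k1 //; have := k2 j; regs.
Qed.

(** * Polynomial running times *)

Definition poly_bounded (f : nat -> nat) :=
  exists a d, forall n, f n <= a * n.+1 ^ d.

Lemma poly_bounded_le f g : (forall n, f n <= g n) -> poly_bounded g -> poly_bounded f.
Proof. by move=> fg [a [d gb]]; exists a, d => n; apply: leq_trans (fg n) (gb n). Qed.

Lemma poly_bounded_const c : poly_bounded (fun=> c).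
Proof. by exists c, 0 => n; rewrite muln1. Qed.

Lemma poly_bounded_id : poly_bounded id.
Proof. by exists 1, 1 => n; rewrite mul1n expn1. Qed.

Lemma poly_boundedD f g :
  poly_bounded f -> poly_bounded g -> poly_bounded (fun n => f n + g n).
Proof.
move=> [a [d fb]] [b [e gb]]; exists (a + b), (d + e) => n.
rewrite mulnDl; apply: leq_add.
  by apply: leq_trans (fb n) _; rewrite leq_mul2l leq_pexp2l ?orbT // leq_addr.
by apply: leq_trans (gb n) _; rewrite leq_mul2l leq_pexp2l ?orbT // leq_addl.
Qed.

Lemma poly_boundedM f g :
  poly_bounded f -> poly_bounded g -> poly_bounded (fun n => f n * g n).
Proof.
move=> [a [d fb]] [b [e gb]]; exists (a * b), (d + e) => n.
by rewrite expnD mulnACA leq_mul.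
Qed.

Lemma poly_boundedS f : poly_bounded f -> poly_bounded (fun n => (f n).+1).
Proof.
move=> fb; apply: poly_bounded_le (poly_boundedD fb (poly_bounded_const 1)) => n.
by rewrite addn1.
Qed.

Lemma poly_boundedX d : poly_bounded (fun n => n ^ d).
Proof. by exists 1, d => n; rewrite mul1n; case: d => // d; rewrite leq_exp2r. Qed.

Lemma loop_cost_poly d f : poly_bounded f -> poly_bounded (fun n => loop_cost n d (f n)).
Proof.
move=> fb; rewrite /loop_cost /power_cost /scale_cost.
by repeat first [ apply: poly_boundedD | apply: poly_boundedS | apply: poly_boundedM
  | exact: poly_bounded_const | exact: poly_bounded_id | exact: poly_boundedX
  | exact: fb ].
Qed.

Lemma ecost_poly e : poly_bounded (ecost^~ e).
Proof.
elim: e => [c|x||a IHa b IHb|a IHa b IHb|a IHa|a IHa|c IHc a IHa b IHb|x d a IHa] /=;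
  rewrite /scale_cost;
  by repeat first [ assumption | apply: loop_cost_poly | exact: poly_bounded_const
    | exact: poly_bounded_id | apply: poly_boundedD | apply: poly_boundedS
    | apply: poly_boundedM ].
Qed.

Lemma scost_poly p : poly_bounded (scost^~ p).
Proof.
elim: p => [|a b|p IHp q IHq|c p IHp q IHq|x d p IHp|x a p IHp] /=;
  by repeat first [ assumption | apply: loop_cost_poly | exact: poly_bounded_const
    | exact: ecost_poly | apply: poly_boundedD | apply: poly_boundedS ].
Qed.

Lemma compile_correct p : exists a d, forall w out,
  (forall i, i < size out ->
     run (head 0 w) (fun=> 0) p (nth 0 w) i = nth 0 out i) ->
  head 0 w < size w ->
  computes_within (compile p) w (a * size w ^ d + a) out.
Proof.
have [a [d cost]] := poly_boundedS (scost_poly p).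
exists a, d => w out res lt_w; set n := head 0 w.
pose s1 := set_reg (initial_state w) 0 (nth 0 w 0).
have sim1 : sim n (fun=> 0) s1 by split=> [|x] //=; rewrite nth0.
have [t [s2 [ex le [_ _ m2]]]] := ok_stmt 0 p sim1.
exists (1 + t), s2; split.
- exact: exec_seq (exec_read _ _ _) ex.
(* The cost is polynomial in [n.+1], which is at most the length of the word. *)
- apply: leq_trans (leq_addr _ _); rewrite add1n.
  apply: leq_trans (le : t < _.+1) _; apply: leq_trans (cost n) _.
  rewrite leq_mul2l; apply/orP; right; case: (d) => // e.
  by rewrite leq_exp2r.
- by move=> i /res; rewrite m2.
Qed.

(** * The recognition program *)

Definition e_double a := EAdd a a.
Definition e_not a := EIf a (EConst 0) (EConst 1).
Definition e_and a b := EIf a b (EConst 0).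
Definition e_eq a b := e_not (EAdd (ESub a b) (ESub b a)).
Definition e_pair a b := EAdd (EScale a) b.
Definition e_sq a := EScale (EScale a).
Definition e_pred a := ESub a (EConst 1).

Definition e_side a := ELoad (EAdd (EConst 1) a).
Definition e_adj a b := ELoad (EAdd (EAdd (EConst 1) EDim) (e_pair a b)).
Definition e_same a b := e_eq (e_side a) (e_side b).
Definition e_forces a b c d :=
  e_and (e_adj a c) (e_and (e_adj b d) (e_and (e_not (e_adj a d)) (e_not (e_adj b c)))).

(* The input is read in place, and the output overwrites it at the very end.  The
   cells from [out_base n] hold the output to be copied or the traced chain, and
   those from [walk_base n] the table of chains, indexed by the length, the code
   [n * u + v] of the source and the two components of the target. *)
Definition out_base n := 4 * (n * n) + n + 10.
Definition e_out a :=
  EAdd (EAdd (EAdd (e_double (e_double (EScale EDim))) EDim) (EConst 10)) a.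

Definition walk_base n := 8 * (n * n) + n + 20.
Definition e_walk_cell t c a b :=
  EAdd (EAdd (EAdd (e_double (e_double (e_double (EScale EDim)))) EDim) (EConst 20))
    (EAdd (e_sq (EAdd (e_sq t) c)) (e_pair a b)).
Definition e_walk t c a b := ELoad (e_walk_cell t c a b).

(* Variables: [xT] is the length of a chain or an index in it, [xC] the code of a
   pair, [(xU, xV)] and [(xP, xQ)] are pairs, [(xX, xY)] is an invertible pair with
   a chain of length [xK] to its reverse, and [(xA, xB)] is the current pair of
   that chain. *)
Local Notation xT := 0.
Local Notation xC := 1.
Local Notation xU := 2.
Local Notation xV := 3.
Local Notation xP := 4.
Local Notation xQ := 5.
Local Notation xX := 6.
Local Notation xY := 7.
Local Notation xK := 8.
Local Notation xA := 9.
Local Notation xB := 10.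

(** Dynamic programming on the length: a chain of length [t > 0] is one of length [t - 1] followed
    by a forcing step. *)
Definition fill_step :=
  SStore (e_walk_cell (EVar xT) (EVar xC) (EVar xU) (EVar xV))
    (EIf (EVar xT)
      (EFind xP 1 (EFind xQ 1
        (e_and (e_walk (e_pred (EVar xT)) (EVar xC) (EVar xP) (EVar xQ))
               (e_forces (EVar xP) (EVar xQ) (EVar xU) (EVar xV)))))
      (e_eq (EVar xC) (e_pair (EVar xU) (EVar xV)))).

Definition fill_walks := SFor xT 2 (SFor xC 2 (SFor xU 1 (SFor xV 1 fill_step))).

Definition e_conflict_length a b :=
  EFind xT 2 (e_walk (EVar xT) (e_pair b a) a b).

Definition e_conflict a b :=
  e_and (e_not (e_eq a b)) (e_and (e_same a b) (e_conflict_length a b)).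

(** As [EFind] reports the last success, this is one more than the greatest code in the class of
    [(a, b)]. *)
Definition e_label a b :=
  EFind xC 2 (EFind xT 2 (e_walk (EVar xT) (EVar xC) a b)).

Definition orientation_step :=
  SStore (e_out (e_pair (EVar xU) (EVar xV)))
    (EIf (e_same (EVar xU) (EVar xV))
      (EIf (ESub (e_label (EVar xV) (EVar xU)) (e_label (EVar xU) (EVar xV)))
        (EConst 2) (EConst 0))
      (e_not (e_adj (EVar xU) (EVar xV)))).

Definition copy_step := SStore (EAdd (EConst 1) (EVar xT)) (ELoad (e_out (EVar xT))).

Definition output_orientation :=
  SSeq (SFor xU 1 (SFor xV 1 orientation_step))
  (SSeq (SFor xT 2 copy_step) (SStore (EConst 0) (EConst 1))).

(* Walks are counted from the reverse of [(xX, xY)], so that the chain is followed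
   forwards by consulting shorter and shorter ones. *)
Definition e_next a b c d :=
  e_and (e_walk (ESub (e_pred (EVar xK)) (EVar xT)) (e_pair (EVar xY) (EVar xX)) c d)
        (e_forces a b c d).

(** The next pair takes two searches: for a first component that admits some second one, then for a
    second component matching it. *)
Definition trace_step :=
  SLet xA (ELoad (e_out (e_double (EVar xT))))
  (SLet xB (ELoad (e_out (EAdd (e_double (EVar xT)) (EConst 1))))
  (SLet xU (e_pred (EFind xP 1 (EFind xQ 1
             (e_next (EVar xA) (EVar xB) (EVar xP) (EVar xQ)))))
  (SLet xV (e_pred (EFind xQ 1 (e_next (EVar xA) (EVar xB) (EVar xU) (EVar xQ))))
  (SSeq (SStore (e_out (EAdd (e_double (EVar xT)) (EConst 2))) (EVar xU))
        (SStore (e_out (EAdd (e_double (EVar xT)) (EConst 3))) (EVar xV)))))).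

Definition trace_conflict :=
  SSeq (SStore (e_out (EConst 0)) (EVar xX))
  (SSeq (SStore (e_out (EConst 1)) (EVar xY)) (SFor xT 2 trace_step)).

(** First components yield edge [xT] of the closed walk, second components edge [xK + xT]. All
    [2 xK] edges are written, the last of them beyond the output word. *)
Definition asteroid_step :=
  SIf (ESub (EVar xK) (EVar xT))
    (SSeq (SStore (EAdd (EConst 2) (e_double (EVar xT)))
                  (ELoad (e_out (e_double (EVar xT)))))
    (SSeq (SStore (EAdd (EConst 3) (e_double (EVar xT)))
                  (ELoad (e_out (EAdd (e_double (EVar xT)) (EConst 2)))))
    (SSeq (SStore (EAdd (EConst 2) (e_double (EAdd (EVar xK) (EVar xT))))
                  (ELoad (e_out (EAdd (e_double (EVar xT)) (EConst 1)))))
          (SStore (EAdd (EConst 3) (e_double (EAdd (EVar xK) (EVar xT))))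
                  (ELoad (e_out (EAdd (e_double (EVar xT)) (EConst 3))))))))
    SSkip.

Definition output_asteroid :=
  SSeq (SStore (EConst 0) (EConst 0))
  (SSeq (SStore (EConst 1) (e_pred (EVar xK))) (SFor xT 2 asteroid_step)).

Definition recognize :=
  SSeq fill_walks
  (SLet xX (EFind xU 1 (EFind xV 1 (e_conflict (EVar xU) (EVar xV))))
  (SIf (EVar xX)
    (SLet xX (e_pred (EVar xX))
    (SLet xY (e_pred (EFind xV 1 (e_conflict (EVar xX) (EVar xV))))
    (SLet xK (e_pred (e_conflict_length (EVar xX) (EVar xY)))
    (SSeq trace_conflict output_asteroid))))
    output_orientation)).

(** * Evaluation of searches and loops *)

Definition last_index N (f : nat -> nat) :=
  foldl (fun r i => if f i != 0 then i.+1 else r) 0 (iota 0 N).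

Lemma last_indexS N f :
  last_index N.+1 f = if f N != 0 then N.+1 else last_index N f.
Proof. by rewrite /last_index iota0S foldl_rcons. Qed.

Lemma last_index_neq0 N f :
  (last_index N f != 0) = [exists i : 'I_N, f i != 0].
Proof.
elim: N => [|N IHN]; first by apply/esym/existsP => -[[]].
rewrite last_indexS; case: ifP => [fN|/negbFE/eqP fN].
  by apply/esym/existsP; exists ord_max.
rewrite IHN; apply/existsP/existsP=> -[i fi]; first by exists (widen_ord (leqnSn N) i).
have [lt|] := ltnP i N; first by exists (Ordinal lt).
by move=> le; case/eqP: fi; rewrite (_ : nat_of_ord i = N) //; have := ltn_ord i; lia.
Qed.

Lemma last_indexP N f : last_index N f != 0 ->
  (last_index N f).-1 < N /\ f (last_index N f).-1 != 0.
Proof.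
elim: N => [//|N IHN]; rewrite last_indexS; case: ifP => [fN _ //|_ /IHN[lt fi]].
by split=> //; apply: leqW.
Qed.

Lemma eq_last_index N f g : (forall i, i < N -> (f i != 0) = (g i != 0)) ->
  last_index N f = last_index N g.
Proof.
elim: N => [//|N IHN] fg; rewrite !last_indexS fg // IHN // => i lt.
by apply: fg; apply: leqW.
Qed.

Lemma eval_find n m v x d a :
  eval n m v (EFind x d a) = last_index (n ^ d) (fun i => eval n m (update v x i) a).
Proof. by []. Qed.

Lemma run_store n v a b m :
  run n v (SStore a b) m = update m (eval n m v a) (eval n m v b).
Proof. by []. Qed.

Lemma eval_if n m v c a b : eval n m v (EIf c a b) =
  if eval n m v c != 0 then eval n m v a else eval n m v b.
Proof. by []. Qed.

Lemma run_for n v x d p m (I : nat -> (nat -> nat) -> Prop) : I 0 m ->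
  (forall i m, i < n ^ d -> I i m -> I i.+1 (run n (update v x i) p m)) ->
  I (n ^ d) (run n v (SFor x d p) m).
Proof.
move=> I0 step /=; move: (n ^ d) step => N; elim: N => [//|N IHN] step.
rewrite iota0S foldl_rcons; apply: (step) => //.
by apply: IHN => i m' lt; apply: step; apply: leqW.
Qed.

Lemma pair_inj N a b c d : b < N -> d < N -> N * a + b = N * c + d -> a = c /\ b = d.
Proof.
move=> b_lt d_lt e; have ac: a = c by apply/eqP; rewrite eqn_leq; nia.
by split=> //; move: e; rewrite ac => /addnI.
Qed.

Lemma pair_lt N a b c d : b < N -> a < c -> N * a + b < N * c + d.
Proof. nia. Qed.

Section Correctness.
Variables (n : nat) (G : bigraph 'I_n).
Implicit Types (x y z : 'I_n * 'I_n) (u v : 'I_n) (m e : nat -> nat).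

Definition code x := n * x.1 + x.2.

Lemma code_lt x : code x < n ^ 2.
Proof. by rewrite /code; case: x => [[u ltu] [v ltv]] /=; nia. Qed.

Lemma code_inj : injective code.
Proof.
move=> [u v] [u' v'] /pair_inj[] //=; try exact: ltn_ord.
by move/val_inj=> -> /val_inj ->.
Qed.

Lemma codeP c : c < n ^ 2 -> exists x, c = code x.
Proof.
move=> lt; have n_gt0: 0 < n by case: (n) lt.
have lt1 : c %/ n < n by rewrite ltn_divLR // -mulnn in lt *.
exists (Ordinal lt1, Ordinal (ltn_pmod c n_gt0)).
by rewrite /code /= mulnC -divn_eq.
Qed.

(** * Forcing chains and their table *)

Fixpoint walks t x y :=
  if t is t'.+1 then [exists z, walks t' x z && forces G z y] else x == y.

Lemma walks_connect t x y : walks t x y -> connect (forces G) x y.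
Proof.
elim: t y => [|t IHt] y /= => [/eqP->|/existsP[z /andP[/IHt xz zy]]] //.
exact: connect_trans xz (connect1 zy).
Qed.

Lemma path_walks s x y :
  path (forces G) x s -> y = last x s -> walks (size s) x y.
Proof.
elim/last_ind: s y => [|s z IHs] y /=; first by move=> _ ->; rewrite eqxx.
rewrite rcons_path last_rcons size_rcons => /andP[ps f] ->.
by apply/existsP; exists (last x s); apply/andP; split=> //; apply: IHs.
Qed.

(** A chain without repetitions visits at most [n^2] pairs, so its length is below [n^2]. *)
Lemma connect_walks x y :
  connect (forces G) x y -> exists2 t, t < n ^ 2 & walks t x y.
Proof.
case/connectP=> s0 p0 ->; case/shortenP: p0 => s ps us _.
exists (size s); last exact: path_walks.
have := max_card (mem (x :: s)); rewrite (card_uniqP us) /= card_prod !card_ord.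
by rewrite mulnn.
Qed.

Definition input_in m :=
  (forall u, m (1 + u) = (u \in partX G)) /\
  (forall u v, m (1 + n + (n * u + v)) = adj G u v).

(** Positional notation with leading digit [t], then [c] in base [n^2] and [a], [b] in base [n]; the
    nested loops thus fill the cells in increasing order. *)
Definition cell t c a b := n * (n * (n * (n * t) + c)) + (n * a + b).

(** Only vanishing matters, since a filled cell may hold the result of a search. *)
Definition walks_in m := forall t x y, t < n ^ 2 ->
  (m (walk_base n + cell t (code x) y.1 y.2) != 0) = walks t x y.

Lemma eval_out m e a : eval n m e (e_out a) = out_base n + eval n m e a.
Proof. by rewrite /= /out_base; lia. Qed.

Lemma eval_walk_cell m e t c a b : eval n m e (e_walk_cell t c a b) =
  walk_base n + cell (eval n m e t) (eval n m e c) (eval n m e a) (eval n m e b).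
Proof. by rewrite /= /walk_base /cell; lia. Qed.

Lemma eval_not m e a : eval n m e (e_not a) = (eval n m e a == 0).
Proof. by rewrite /=; case: eqP. Qed.

Lemma eval_and m e a b :
  (eval n m e (e_and a b) != 0) = (eval n m e a != 0) && (eval n m e b != 0).
Proof. by rewrite /=; case: (eval n m e a == 0). Qed.

Lemma eval_eq m e a b : eval n m e (e_eq a b) = (eval n m e a == eval n m e b).
Proof. by rewrite eval_not /=; congr nat_of_bool; apply/eqP/eqP; lia. Qed.

Lemma eval_adj m e a b u v : input_in m ->
  eval n m e a = u -> eval n m e b = v -> eval n m e (e_adj a b) = adj G u v.
Proof. by case=> _ i /= -> ->. Qed.

Lemma eval_same m e a b u v : input_in m ->
  eval n m e a = u -> eval n m e b = v -> eval n m e (e_same a b) = same_side G u v.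
Proof.
case=> i _ ea eb; rewrite eval_eq /= ea eb !i.
by rewrite /same_side; do 2 case: (_ \in _).
Qed.

Lemma eval_forces m e a b c d x y : input_in m ->
  eval n m e a = x.1 -> eval n m e b = x.2 ->
  eval n m e c = y.1 -> eval n m e d = y.2 ->
  (eval n m e (e_forces a b c d) != 0) = forces G x y.
Proof.
move=> i ea eb ec ed; rewrite /e_forces !eval_and !eval_not.
rewrite (eval_adj i ea ec) (eval_adj i eb ed) (eval_adj i ea ed) (eval_adj i eb ec).
by rewrite /forces; do 4 case: (adj G _ _).
Qed.

Lemma eval_walk m e t c a b x y : walks_in m -> eval n m e t < n ^ 2 ->
  eval n m e c = code x -> eval n m e a = y.1 -> eval n m e b = y.2 ->
  (eval n m e (e_walk t c a b) != 0) = walks (eval n m e t) x y.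
Proof.
move=> w lt ec ea eb; have := w _ x y lt; rewrite -ec -ea -eb -eval_walk_cell.
by [].
Qed.

Lemma find_pair m e a (c d : nat) :
  (eval n m e (EFind c 1 (EFind d 1 a)) != 0) =
  [exists x : 'I_n * 'I_n, eval n m (update (update e c x.1) d x.2) a != 0].
Proof.
rewrite eval_find expn1 last_index_neq0.
apply/existsP/existsP=> [[u]|[[u v] /= h]].
  by rewrite eval_find expn1 last_index_neq0 => /existsP[v h]; exists (u, v).
exists u; rewrite -[X in X != 0]/(last_index (n ^ 1)
  (fun i => eval n m (update (update e c u) d i) a)) expn1 last_index_neq0.
by apply/existsP; exists v.
Qed.

Lemma cell_inj t c a b t' c' a' b' : c < n ^ 2 -> a < n -> b < n ->
  c' < n ^ 2 -> a' < n -> b' < n -> cell t c a b = cell t' c' a' b' ->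
  [/\ t = t', c = c', a = a' & b = b'].
Proof.
rewrite /cell -mulnn => lc la lb lc' la' lb'; rewrite !addnA -!mulnDr.
case/pair_inj=> // /pair_inj[] //; rewrite !mulnA => /pair_inj[] // -> -> -> ->.
Qed.

Lemma cell_lt t c a b t' c' a' b' : c < n ^ 2 -> a < n -> b < n -> t < t' ->
  cell t c a b < cell t' c' a' b'.
Proof.
have cellE t0 c0 a0 b0 : cell t0 c0 a0 b0 = n * n * (n * n * t0 + c0) + (n * a0 + b0).
  by rewrite /cell; lia.
rewrite -mulnn !cellE => lc la lb lt; apply: pair_lt; first by nia.
exact: pair_lt.
Qed.

Lemma input_in_low m m' :
  (forall d, d < out_base n -> m d = m' d) -> input_in m' -> input_in m.
Proof.
move=> low [i1 i2]; split=> [u|u v]; rewrite low // /out_base.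
  by have := ltn_ord u; lia.
by have := ltn_ord u; have := ltn_ord v; nia.
Qed.

Lemma fill_walks_correct e m0 : input_in m0 ->
  let m := run n e fill_walks m0 in
  walks_in m /\ forall a, a < walk_base n -> m a = m0 a.
Proof.
move=> in0 /=.
(* The cells before [r] are correct; the layer [t - 1] that a step reads lies entirely before its
   own cell. *)
pose I r m := (forall t x y, t < n ^ 2 -> cell t (code x) y.1 y.2 < r ->
     (m (walk_base n + cell t (code x) y.1 y.2) != 0) = walks t x y)
  /\ forall a, a < walk_base n -> m a = m0 a.
suff [w low]: I (cell (n ^ 2) 0 0 0) (run n e fill_walks m0).
  split=> // t x y lt; apply: w => //.
  by apply: cell_lt; rewrite ?code_lt.
have step e' t c a b m : t < n ^ 2 -> c < n ^ 2 -> a < n -> b < n ->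
    e' xT = t -> e' xC = c -> e' xU = a -> e' xV = b -> I (cell t c a b) m ->
    I (cell t c a b).+1 (run n e' fill_step m).
  move=> lt_t lt_c lt_a lt_b eT eC eU eV [w low].
  rewrite /fill_step; set val := EIf _ _ _; rewrite run_store eval_walk_cell.
  set addr := _ + _; have -> : addr = walk_base n + cell t c a b.
    by rewrite /addr /= eT eC eU eV.
  have [x ec] := codeP lt_c; pose y : 'I_n * 'I_n := (Ordinal lt_a, Ordinal lt_b).
  have in_m : input_in m.
    apply: input_in_low in0 => d lt; rewrite low //.
    by move: lt; rewrite /out_base /walk_base; lia.
  have eval_val : (eval n m e' val != 0) = walks t x y.
    rewrite /val eval_if [eval _ _ _ (EVar xT)]/= eT.
    case: t lt_t eT low w {addr} => [|t'] lt_t eT low w.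
      rewrite eqxx eval_eq /= eC eU eV ec -[n * a + b]/(code y) (inj_eq code_inj).
      by case: (x == y).
    rewrite (erefl : (t'.+1 != 0) = true) find_pair.
    apply: eq_existsb => z; rewrite eval_and; congr (_ && _).
      rewrite -[eval _ _ _ _]/(m (eval n m (update (update e' xP z.1) xQ z.2)
        (e_walk_cell (e_pred (EVar xT)) (EVar xC) (EVar xP) (EVar xQ)))).
      rewrite eval_walk_cell /= /update /= eT eC subn1 /= ec w //; first by lia.
      by apply: cell_lt; rewrite ?code_lt.
    by apply: eval_forces; rewrite //= /update /= ?eU ?eV.
  split=> [t' x' y' lt'|d lt']; last by rewrite /update ltn_eqF ?low //; lia.
  rewrite ltnS leq_eqVlt => /predU1P[|lt].
    rewrite ec => /cell_inj[] //; try exact: ltn_ord; try exact: code_lt.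
    move=> -> /code_inj-> e1 e2; rewrite /update e1 e2 eqxx eval_val.
    by congr walks; case: (y') e1 e2 => u v /= e1 e2; congr pair; apply: val_inj.
  by rewrite /update eqn_add2l (ltn_eqF lt) w.
apply: (run_for (I := fun t => I (cell t 0 0 0))).
  split=> // t x y _ ; rewrite /cell; lia.
move=> t m1 lt_t I1.
(* The end of each inner loop is the cell at which the next round of the outer loop starts. *)
rewrite (_ : cell t.+1 0 0 0 = cell t (n ^ 2) 0 0); last by rewrite /cell -mulnn; lia.
apply: (run_for (I := fun c => I (cell t c 0 0))) => // c m2 lt_c I2.
rewrite (_ : cell t c.+1 0 0 = cell t c (n ^ 1) 0); last by rewrite /cell expn1; lia.
apply: (run_for (I := fun a => I (cell t c a 0))) => // a m3 lt_a I3.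
rewrite (_ : cell t c a.+1 0 = cell t c a (n ^ 1)); last by rewrite /cell expn1; lia.
apply: (run_for (I := fun b => I (cell t c a b))) => // b m4 lt_b I4.
rewrite expn1 in lt_a lt_b.
rewrite (_ : cell t c a b.+1 = (cell t c a b).+1); last by rewrite /cell !addnS.
exact: step.
Qed.

Lemma eval_load m e a : eval n m e (ELoad a) = m (eval n m e a).
Proof. by []. Qed.

Lemma eval_sub m e a b :
  eval n m e (ESub a b) = eval n m e a - eval n m e b.
Proof. by []. Qed.

(** * Conflicts and class labels *)

Definition conflict_length x := last_index (n ^ 2) (fun t => walks t (swap x) x).

Definition conflicting x :=
  [&& x.1 != x.2, same_side G x.1 x.2 & conflict_length x != 0].

Lemma last_index_walks x y :
  (last_index (n ^ 2) (fun t => walks t x y) != 0) = connect (forces G) x y.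
Proof.
rewrite last_index_neq0; apply/existsP/idP=> [[t]|/connect_walks[t lt w]].
  by rewrite eqb0 negbK => /walks_connect.
by exists (Ordinal lt); rewrite /= w.
Qed.

(** The form [p.+1] keeps the variables apart from [xT], which the search rebinds; likewise [p.+2]
    in [eval_label] avoids both [xT] and [xC]. *)
Lemma eval_conflict_length m e p q x : walks_in m ->
  e p.+1 = x.1 -> e q.+1 = x.2 ->
  eval n m e (e_conflict_length (EVar p.+1) (EVar q.+1)) = conflict_length x.
Proof.
move=> w ep eq; rewrite eval_find; apply: eq_last_index => t lt.
by rewrite (eval_walk (x := swap x) (y := x) w) /= /update /= ?ep ?eq //; case: (walks _ _ _).
Qed.

Lemma eval_conflict m e p q x : input_in m -> walks_in m ->
  e p.+1 = x.1 -> e q.+1 = x.2 ->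
  (eval n m e (e_conflict (EVar p.+1) (EVar q.+1)) != 0) = conflicting x.
Proof.
move=> i w ep eq; rewrite /e_conflict !eval_and eval_not eval_eq.
rewrite (eval_same i (u := x.1) (v := x.2)) // (eval_conflict_length w ep eq).
rewrite -[eval _ _ _ (EVar p.+1)]/(e p.+1) -[eval _ _ _ (EVar q.+1)]/(e q.+1) ep eq.
rewrite /conflicting -[x.1 != x.2]/(val x.1 != val x.2).
by case: (val x.1 == val x.2); case: same_side.
Qed.

Lemma conflicting_connect u v :
  conflicting (u, v) = [&& u != v, same_side G u v & connect (forces G) (u, v) (v, u)].
Proof. by rewrite /conflicting last_index_walks connect_forces_sym. Qed.

Lemma conflict_freeP : conflict_free G <-> forall x, ~~ conflicting x.
Proof.
split=> [cf [u v]|nc u v neq s]; first rewrite conflicting_connect.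
  by apply/negP=> /and3P[neq s]; apply/negP/cf.
by have := nc (u, v); rewrite conflicting_connect neq s.
Qed.

Definition label x := last_index (n ^ 2)
  (fun c => [exists z, (code z == c) && connect (forces G) z x]).

Lemma eval_label m e p q x : walks_in m -> e p.+2 = x.1 -> e q.+2 = x.2 ->
  eval n m e (e_label (EVar p.+2) (EVar q.+2)) = label x.
Proof.
move=> w ep eq; rewrite eval_find; apply: eq_last_index => c /codeP[z ->].
rewrite eval_find -(eq_last_index (f := fun t => walks t z x)) ?last_index_walks.
  rewrite eqb0 negbK; apply/idP/existsP=> [zx|[z' /andP[/eqP/code_inj->]]] //.
  by exists z; rewrite eqxx.
move=> t lt; rewrite (eval_walk (x := z) (y := x) w) /= /update /= ?ep ?eq //.
by case: (walks _ _ _).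
Qed.

Lemma label_forces x y : forces G x y -> label x = label y.
Proof.
move=> f; apply: eq_last_index => c _; congr (nat_of_bool _ != 0).
apply: eq_existsb => z; congr (_ && _).
by apply: same_connect_r; [exact: connect_forces_sym | exact: connect1].
Qed.

Lemma labelP x : exists2 z, (label x).-1 = code z & connect (forces G) z x.
Proof.
have : label x != 0.
  rewrite last_index_neq0; apply/existsP; exists (Ordinal (code_lt x)).
  by rewrite eqb0 negbK; apply/existsP; exists x; rewrite eqxx connect0.
by case/last_indexP=> _; rewrite eqb0 negbK => /existsP[z /andP[/eqP]]; exists z.
Qed.

(** By [labelP] a label determines a member of its class, so equal labels would put the pair and its
    reverse in one class. *)
Lemma label_swap : conflict_free G -> forall u v,
  u != v -> same_side G u v -> label (u, v) != label (v, u).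
Proof.
move=> cf u v neq s; apply: contra (cf u v neq s) => /eqP e.
have [z ez zx] := labelP (u, v); have [z' ez' zx'] := labelP (v, u).
move: zx'; rewrite -(code_inj (etrans (esym ez) (etrans (congr1 predn e) ez'))).
by apply: connect_trans; rewrite connect_forces_sym.
Qed.

(** The zone left free is the scratch space, so both the input and the table of chains carry
    over. *)
Definition same_tables m m' :=
  forall d, d < out_base n \/ walk_base n <= d -> m d = m' d.

Lemma same_tables_input m m' : same_tables m m' -> input_in m' -> input_in m.
Proof. by move=> st; apply: input_in_low => d lt; rewrite st //; left. Qed.

Lemma same_tables_walks m m' : same_tables m m' -> walks_in m' -> walks_in m.
Proof. by move=> st w t x y lt; rewrite st ?w //; right; rewrite leq_addr. Qed.

Lemma same_tables_update m m' d a : same_tables m m' ->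
  d < 4 * (n * n) + 10 -> same_tables (update m (out_base n + d) a) m'.
Proof.
move=> st lt d' h; rewrite -st // /update; case: eqP h => // ->.
by rewrite /walk_base /out_base; lia.
Qed.

(** * Writing the orientation *)

Definition orientation_entry x :=
  if same_side G x.1 x.2 then (label x < label (swap x)).*2 else ~~ adj G x.1 x.2 : nat.

Lemma output_orientation_correct e m0 : input_in m0 -> walks_in m0 ->
  let m := run n e output_orientation m0 in
  m 0 = 1 /\ forall x, m (1 + code x) = orientation_entry x.
Proof.
move=> in0 w0 m.
pose I r m := same_tables m m0 /\
  forall x, code x < r -> m (out_base n + code x) = orientation_entry x.
pose m1 := run n e (SFor xU 1 (SFor xV 1 orientation_step)) m0.
have [_ m1P] : I (n * n ^ 1 + 0) m1.
  apply: (run_for (I := fun a => I (n * a + 0))); first by split=> // x; rewrite muln0.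
  move=> a m' lt_a Ia; rewrite expn1 in lt_a.
  rewrite (_ : n * a.+1 + 0 = n * a + n ^ 1); last by rewrite expn1; lia.
  apply: (run_for (I := fun b => I (n * a + b))) => // b m2 lt_b [st ent].
  rewrite expn1 in lt_b; pose x : 'I_n * 'I_n := (Ordinal lt_a, Ordinal lt_b).
  have i2 := same_tables_input st in0; have w2 := same_tables_walks st w0.
  rewrite /orientation_step; set val := EIf _ _ _.
  rewrite run_store eval_out [eval _ _ _ (e_pair _ _)]/= addnS.
  rewrite -[n * _ + _]/(code x).
  have -> : eval n m2 (update (update e xU a) xV b) val = orientation_entry x.
    rewrite /val eval_if (eval_same i2 (u := x.1) (v := x.2)) // /orientation_entry.
    rewrite eqb0 negbK; case: same_side.
      rewrite eval_if eval_sub.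
      set e' := update _ xV b.
      rewrite (@eval_label m2 e' 0 1 x w2 erefl erefl).
      rewrite (@eval_label m2 e' 1 0 (swap x) w2 erefl erefl).
      by rewrite subn_eq0 -ltnNge; case: ltnP.
    by rewrite eval_not (eval_adj i2 (u := x.1) (v := x.2)) // eqb0.
  split; first by apply: same_tables_update => //; have := code_lt x; lia.
  move=> y; rewrite ltnS leq_eqVlt => /predU1P[/code_inj->|lt].
    by rewrite /update eqxx.
  by rewrite /update eqn_add2l (ltn_eqF lt) ent.
(* Copying proceeds upwards and destroys the input, but the source cell [out_base n + i] lies above
   every cell overwritten so far. *)
pose J r m := (forall j, j < r -> m (1 + j) = m1 (out_base n + j))
  /\ forall d, r < d -> m d = m1 d.
have [m2P _] : J (n ^ 2) (run n e (SFor xT 2 copy_step) m1).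
  apply: run_for => // i m' lt_i [cp id]; rewrite run_store.
  have -> : eval n m' (update e xT i) (ELoad (e_out (EVar xT))) = m1 (out_base n + i).
    by rewrite eval_load eval_out /= id // /out_base; lia.
  rewrite /=; split=> [j|d lt]; last by rewrite /update gtn_eqF ?id //; lia.
  rewrite ltnS leq_eqVlt /update /= => /predU1P[->|lt]; first by rewrite eqxx.
  by rewrite ltn_eqF ?cp.
split=> // x; rewrite -[LHS]/(run n e (SFor xT 2 copy_step) m1 (1 + code x)).
by rewrite m2P ?code_lt // m1P // expn1 addn0 mulnn code_lt.
Qed.

(** * Tracing a chain to the reverse pair *)

Lemma eval_next m e a b k i c d x y z : input_in m -> walks_in m ->
  e xA = z.1 -> e xB = z.2 -> e xX = x.1 -> e xY = x.2 -> e xK = k -> e xT = i ->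
  i < k -> k <= n ^ 2 -> eval n m e c = y.1 -> eval n m e d = y.2 ->
  a = EVar xA -> b = EVar xB ->
  (eval n m e (e_next a b c d) != 0) = walks (k.-1 - i) (swap x) y && forces G z y.
Proof.
move=> im wm eA eB eX eY eK eT lt le ec ed -> ->; rewrite eval_and.
have et : eval n m e (ESub (e_pred (EVar xK)) (EVar xT)) = k.-1 - i.
  by rewrite /= eK eT subn1.
rewrite (eval_walk (x := swap x) (y := y) wm) ?et //; first last.
- by rewrite /= eX eY.
- by lia.
by rewrite (eval_forces (x := z) (y := y) im).
Qed.

Lemma run_let e r a p m :
  run n e (SLet r a p) m = run n (update e r (eval n m e a)) p m.
Proof. by []. Qed.

Lemma run_seq e p q m : run n e (SSeq p q) m = run n e q (run n e p m).
Proof. by []. Qed.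

Lemma eval_pred m e a : eval n m e (e_pred a) = (eval n m e a).-1.
Proof. exact: subn1. Qed.

Definition trace_env e m :=
  let eA := update e xA (m (out_base n + 2 * e xT)) in
  let eB := update eA xB (m (out_base n + (2 * e xT + 1))) in
  let eU := update eB xU (eval n m eB (e_pred (EFind xP 1 (EFind xQ 1
             (e_next (EVar xA) (EVar xB) (EVar xP) (EVar xQ)))))) in
  update eU xV (eval n m eU
    (e_pred (EFind xQ 1 (e_next (EVar xA) (EVar xB) (EVar xU) (EVar xQ))))).

Lemma update_neq (f : nat -> nat) i a j : j != i -> update f i a j = f j.
Proof. by rewrite /update => /negbTE->. Qed.

Lemma eval_findP m e r a : eval n m e (EFind r 1 a) != 0 ->
  (eval n m e (EFind r 1 a)).-1 < n /\
  eval n m (update e r (eval n m e (EFind r 1 a)).-1) a != 0.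
Proof. by rewrite eval_find expn1 => /last_indexP. Qed.

Lemma eval_double m e r : eval n m e (e_double (EVar r)) = 2 * e r.
Proof. by rewrite mul2n -addnn. Qed.

Lemma eval_doubleD m e r c :
  eval n m e (EAdd (e_double (EVar r)) (EConst c)) = 2 * e r + c.
Proof. by rewrite mul2n -addnn. Qed.

Lemma eval_var m e r : eval n m e (EVar r) = e r.
Proof. by []. Qed.

Lemma run_trace_step e m : run n e trace_step m =
  update (update m (out_base n + (2 * e xT + 2)) (trace_env e m xU))
    (out_base n + (2 * e xT + 3)) (trace_env e m xV).
Proof.
have store e' : e' xT = e xT -> run n e'
    (SSeq (SStore (e_out (EAdd (e_double (EVar xT)) (EConst 2))) (EVar xU))
          (SStore (e_out (EAdd (e_double (EVar xT)) (EConst 3))) (EVar xV))) m =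
    update (update m (out_base n + (2 * e xT + 2)) (e' xU))
      (out_base n + (2 * e xT + 3)) (e' xV).
  move=> eT; rewrite run_seq !run_store !eval_out !eval_doubleD.
  by rewrite !eval_var eT.
rewrite /trace_step !run_let store; last by rewrite !update_neq.
rewrite !eval_load !eval_out eval_doubleD eval_double.
rewrite update_neq //; exact: erefl.
Qed.

(** The last step of the chain from [swap x] to [z], read backwards by symmetry of [forces], leads
    to a pair one step closer to [swap x]; the searches find such a pair. *)
Lemma trace_step_correct e m k i x z : input_in m -> walks_in m ->
  e xX = x.1 -> e xY = x.2 -> e xK = k -> e xT = i -> i < k -> k <= n ^ 2 ->
  m (out_base n + 2 * i) = z.1 -> m (out_base n + (2 * i + 1)) = z.2 ->
  walks (k - i) (swap x) z ->
  exists y, [/\ run n e trace_step m =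
      update (update m (out_base n + (2 * i + 2)) y.1) (out_base n + (2 * i + 3)) y.2,
    walks (k.-1 - i) (swap x) y & forces G z y].
Proof.
move=> im wm eX eY eK eT lt_i le_k mz1 mz2 wz.
pose F y := walks (k.-1 - i) (swap x) y && forces G z y.
have [y0 Fy0] : exists y, F y.
  move: wz; rewrite (_ : k - i = (k.-1 - i).+1) /=; last by lia.
  by case/existsP=> y; rewrite forces_sym; exists y.
rewrite run_trace_step /trace_env eT mz1 mz2.
set eB := update (update e xA _) xB _.
have next e' c d y : e' xA = z.1 -> e' xB = z.2 -> e' xX = x.1 -> e' xY = x.2 ->
    e' xK = k -> e' xT = i -> eval n m e' c = y.1 -> eval n m e' d = y.2 ->
    (eval n m e' (e_next (EVar xA) (EVar xB) c d) != 0) = F y.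
  by move=> hA hB hX hY hK hT hc hd; apply: (eval_next im wm (k := k)).
set find1 := EFind xP 1 _.
have find1_ex : eval n m eB find1 != 0.
  by rewrite find_pair; apply/existsP; exists y0; rewrite (next _ _ _ y0).
have [] := eval_findP find1_ex; rewrite -/find1.
set p := (eval n m eB find1).-1 => lt_p.
rewrite eval_find expn1 last_index_neq0 => /existsP[q0].
rewrite (next _ _ _ (Ordinal lt_p, q0)) // => Fq0.
rewrite eval_pred -/p; set eU := update eB xU p; rewrite eval_pred.
set find2 := EFind xQ 1 _.
have find2_ex : eval n m eU find2 != 0.
  rewrite eval_find expn1 last_index_neq0; apply/existsP; exists q0.
  by rewrite (next _ _ _ (Ordinal lt_p, q0)).
have [] := eval_findP find2_ex.
set q := (eval n m eU find2).-1 => lt_q.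
rewrite (next _ _ _ (Ordinal lt_p, Ordinal lt_q)) // => /andP[w f].
by exists (Ordinal lt_p, Ordinal lt_q).
Qed.

Lemma trace_conflict_correct e m0 k x : input_in m0 -> walks_in m0 ->
  e xX = x.1 -> e xY = x.2 -> e xK = k -> k < n ^ 2 -> walks k (swap x) x ->
  let m := run n e trace_conflict m0 in
  exists f : nat -> 'I_n * 'I_n,
    [/\ f 0 = x, f k = swap x, forall i, i < k -> forces G (f i) (f i.+1)
      & forall i, i <= k -> m (out_base n + 2 * i) = (f i).1
                         /\ m (out_base n + (2 * i + 1)) = (f i).2].
Proof.
move=> in0 w0 eX eY eK lt_k wk m.
pose I i m := same_tables m m0 /\ exists f : nat -> 'I_n * 'I_n,
  [/\ f 0 = x, forall j, j < i -> j < k -> forces G (f j) (f j.+1)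
   & forall j, j <= i -> j <= k -> [/\ walks (k - j) (swap x) (f j),
       m (out_base n + 2 * j) = (f j).1
     & m (out_base n + (2 * j + 1)) = (f j).2]].
have [_ [f [f0 ff fm]]] : I (n ^ 2) m.
  rewrite /m /trace_conflict !run_seq  !run_store !eval_out.
  rewrite -[eval _ _ _ (EVar xX)]/(e xX) -[eval _ _ _ (EVar xY)]/(e xY) eX eY.
  rewrite [eval _ _ _ (EConst 0)]/= [eval _ _ _ (EConst 1)]/=.
  apply: run_for.
    split; first by do 2 (apply: same_tables_update; last by lia).
    exists (fun=> x); split=> // j; rewrite leqn0 => /eqP-> _; rewrite subn0.
    by split; rewrite // /update /= ?eqxx // eqn_add2l.
  move=> i m1 lt_i [st [f [f0 ff fm]]].
  have im := same_tables_input st in0; have wm := same_tables_walks st w0.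
  have st' p q : same_tables (update (update m1 (out_base n + (2 * i + 2)) p)
      (out_base n + (2 * i + 3)) q) m0.
    by do 2 (apply: same_tables_update; last by lia).
  have keep p q d : d < 2 * i + 2 ->
      update (update m1 (out_base n + (2 * i + 2)) p) (out_base n + (2 * i + 3)) q
        (out_base n + d) = m1 (out_base n + d).
    by move=> lt; rewrite /update !eqn_add2l !ltn_eqF //; lia.
  (* Beyond the end of the chain the step still writes, but only above the cells that hold the
     chain. *)
  have [le_k|lt_ik] := leqP k i.
    rewrite run_trace_step; split; first exact: st'.
    exists f; split=> // j le lt; first by apply: ff; lia.
    rewrite !keep; try by rewrite -?[_ xT]/i; lia.
    by apply: fm => //; lia.
  have [wz z1 z2] := fm i (leqnn i) (ltnW lt_ik).
  have [y [-> wy fy]] := @trace_step_correct (update e xT i) m1 k i x (f i)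
    im wm eX eY eK erefl lt_ik (ltnW lt_k) z1 z2 wz.
  split=> //; exists (fun j => if j == i.+1 then y else f j); split=> // j le lt.
    rewrite (ltn_eqF le) eqSS; case: eqP => [->|ne] //.
    by apply: ff => //; lia.
  case: eqP => [e_j|ne].
    have e2j : 2 * j = 2 * i + 2 by lia.
    have e3j : 2 * j + 1 = 2 * i + 3 by lia.
    split; first by rewrite (_ : k - j = k.-1 - i) //; lia.
      by rewrite e2j update_neq ?eqn_add2l /update ?eqxx //; lia.
    by rewrite e3j /update eqxx.
  by rewrite !keep; try lia; apply: fm => //; lia.
exists f; split=> //.
- have [w _ _] := fm k (ltnW lt_k) (leqnn k).
  by move: w; rewrite subnn /= => /eqP.
- by move=> i lt; apply: ff; lia.
by move=> i le; have [] := fm i _ le; first by lia.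
Qed.

(** * Writing the asteroid *)

Lemma closed_walk_le k (f : nat -> 'I_n * 'I_n) j : f k.+1 = swap (f 0) -> j <= k.+1 ->
  closed_walk k f j = (f j).1 /\ closed_walk k f (k.+1 + j) = (f j).2.
Proof.
move=> fk le; have unr : unroll k f j = f j.
  move: le; rewrite leq_eqVlt => /predU1P[->|lt].
    by rewrite /unroll modnn divnn.
  by rewrite /unroll modn_small // divn_small.
by rewrite addnC closed_walk_snd /closed_walk unr.
Qed.

Lemma run_if e c p q m : run n e (SIf c p q) m =
  if eval n m e c != 0 then run n e p m else run n e q m.
Proof. by []. Qed.

Lemma run_asteroid_step e m (k i : nat) (w : nat -> nat) : e xK = k -> e xT = i ->
  k < n ^ 2 -> (forall j, j < 4 -> m (out_base n + (2 * i + j)) = w j) ->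
  run n e asteroid_step m =
  if i < k then
    update (update (update (update m (2 + 2 * i) (w 0)) (3 + 2 * i) (w 2))
      (2 + 2 * (k + i)) (w 1)) (3 + 2 * (k + i)) (w 3)
  else m.
Proof.
move=> eK eT lt_k mw; rewrite run_if eval_sub !eval_var eK eT.
rewrite subn_eq0 -ltnNge; case: ifP => // lt_i.
rewrite !run_seq !run_store !eval_load !eval_out !eval_doubleD eval_double eT.
have adr m' c : eval n m' e (EAdd (EConst c) (e_double (EVar xT))) = c + 2 * i.
  by rewrite mul2n -addnn -eT.
have adrK m' c : eval n m' e (EAdd (EConst c) (e_double (EAdd (EVar xK) (EVar xT))))
    = c + 2 * (k + i).
  by rewrite mul2n -addnn -eT -eK.
(* Both [k] and [i] are below [n^2], so the edges stay below [out_base n] and leave the traced chain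
   intact. *)
have lt4 : 3 + 2 * (k + i) < out_base n by rewrite /out_base; lia.
have upd m' a p d : a < out_base n -> update m' a p (out_base n + d) = m' (out_base n + d).
  by move=> lt_a; rewrite /update gtn_eqF //; lia.
rewrite !adr !adrK !upd; try lia.
by rewrite !mw // -(mw 0) // addn0.
Qed.

Lemma output_asteroid_correct e m1 k (f : nat -> 'I_n * 'I_n) :
  e xK = k.+1 -> k.+1 < n ^ 2 -> f k.+1 = swap (f 0) ->
  (forall i, i <= k.+1 -> m1 (out_base n + 2 * i) = (f i).1
                        /\ m1 (out_base n + (2 * i + 1)) = (f i).2) ->
  let m := run n e output_asteroid m1 in
  [/\ m 0 = 0, m 1 = k & forall j, j < k.+1.*2 ->
     m (2 + 2 * j) = closed_walk k f j /\ m (3 + 2 * j) = closed_walk k f j.+1].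
Proof.
move=> eK lt_k fk fm m.
pose I i m := [/\ m 0 = 0, m 1 = k, forall d, m (out_base n + d) = m1 (out_base n + d)
  & forall j, j < i -> j <= k ->
    [/\ m (2 + 2 * j) = (f j).1, m (3 + 2 * j) = (f j.+1).1,
       m (2 + 2 * (k.+1 + j)) = (f j).2 & m (3 + 2 * (k.+1 + j)) = (f j.+1).2]].
have [m_0 m_1 _ mf] : I (n ^ 2) m.
  rewrite /m /output_asteroid !run_seq !run_store eval_pred eval_var eK.
  rewrite [eval _ _ _ (EConst 0)]/= [eval _ _ _ (EConst 1)]/= [k.+1.-1]/=.
  apply: run_for; first split=> // d.
    by rewrite /update !gtn_eqF // /out_base; lia.
  move=> i m2 lt_i [m20 m21 high m2f].
  rewrite (@run_asteroid_step _ _ k.+1 i (fun j => m2 (out_base n + (2 * i + j)))) //.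
  have [lt|le] := ltnP i k.+1; last first.
    by split=> // j lt_j le_j; apply: m2f => //; lia.
  have [f1 f2] := fm i (ltnW lt); have [f3 f4] := fm i.+1 lt.
  have e2 : 2 * i + 2 = 2 * i.+1 by lia.
  have e3 : 2 * i + 3 = 2 * i.+1 + 1 by lia.
  rewrite !high e2 e3 addn0 f1 f2 f3 f4.
  have lt4 : 3 + 2 * (k.+1 + i) < out_base n by rewrite /out_base; lia.
  split.
  - by rewrite /update /= m20.
  - by rewrite /update /= m21.
  - by move=> d; rewrite -high /update !gtn_eqF //; lia.
  move=> j; rewrite ltnS leq_eqVlt => /predU1P[-> _|lt_j le_j].
    by split; rewrite /update; do !(case: eqP => [?|?]; try lia).
  have [g1 g2 g3 g4] := m2f j lt_j le_j.
  by split; rewrite /update; do !(case: eqP => [?|?]; try lia).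
(* Edges with index at least [k+1] come from the second components, written in round [j - (k+1)]. *)
split=> // j lt_j; have [le|lt] := leqP k.+1 j.
  have lt' : j - k.+1 <= k by lia.
  have [|_ _ h1 h2] := mf (j - k.+1) _ lt'; first by lia.
  have [_ w1] := closed_walk_le (j := j - k.+1) fk (leqW lt').
  have [_ w2] := closed_walk_le (j := (j - k.+1).+1) fk lt'.
  by move: h1 h2 w1 w2; rewrite addnS subnKC // => -> -> -> ->.
have [|h1 h2 _ _] := mf j _ lt; first by lia.
have [w1 _] := closed_walk_le fk (ltnW lt); have [w2 _] := closed_walk_le fk lt.
by rewrite h1 h2 w1 w2.
Qed.

(** * The two outcomes of the program *)

Lemma find_conflict e m : input_in m -> walks_in m ->
  (eval n m e (EFind xU 1 (EFind xV 1 (e_conflict (EVar xU) (EVar xV)))) != 0)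
    = [exists x, conflicting x].
Proof.
move=> im wm; rewrite find_pair; apply: eq_existsb => x.
exact: (@eval_conflict m (update (update e xU x.1) xV x.2) 1 2 x im wm erefl erefl).
Qed.

Lemma filled_tables e m0 : input_in m0 ->
  let m := run n e fill_walks m0 in input_in m /\ walks_in m.
Proof.
move=> in0 m; have [w low] := fill_walks_correct e in0; split=> //.
apply: input_in_low in0 => d lt; rewrite /m low //.
by move: lt; rewrite /out_base /walk_base; lia.
Qed.

Lemma recognize_yes e m0 : input_in m0 -> [forall x, ~~ conflicting x] ->
  let m := run n e recognize m0 in
  m 0 = 1 /\ forall x, m (1 + code x) = orientation_entry x.
Proof.
move=> in0 nc m; have [in1 w1] := filled_tables e in0.
have no_find := find_conflict e in1 w1.
rewrite (negbTE (_ : ~~ [exists x, conflicting x])) in no_find; last first.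
  by rewrite negb_exists.
move/negbFE/eqP: no_find => no_find.
have -> : m = run n (update e xX 0) output_orientation (run n e fill_walks m0).
  by rewrite /m /recognize run_seq run_let no_find run_if.
exact: output_orientation_correct.
Qed.

Lemma recognize_no e m0 : input_in m0 -> [exists x, conflicting x] ->
  let m := run n e recognize m0 in
  exists k (f : nat -> 'I_n * 'I_n),
    [/\ f k.+1 = swap (f 0), same_side G (f 0).1 (f 0).2,
        forall i, i <= k -> forces G (f i) (f i.+1)
      & [/\ m 0 = 0, m 1 = k & forall j, j < k.+1.*2 ->
     m (2 + 2 * j) = closed_walk k f j /\ m (3 + 2 * j) = closed_walk k f j.+1]].
Proof.
move=> in0 cf m; have [in1 w1] := filled_tables e in0.
rewrite /m /recognize run_seq run_let run_if eval_var.
set m1 := run n e fill_walks m0 in in1 w1 *.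
set find1 := EFind xU 1 _; have found : eval n m1 e find1 != 0 by rewrite find_conflict.
set e1 := update e xX _; rewrite [e1 xX]/(eval n m1 e find1) found.
have e1X : e1 xX = eval n m1 e find1 by [].
rewrite run_let eval_pred eval_var e1X.
have [] := eval_findP found; set p := (eval n m1 e find1).-1 => lt_p.
rewrite eval_find expn1 last_index_neq0 => /existsP[q0].
rewrite (@eval_conflict m1 _ 1 2 (Ordinal lt_p, q0) in1 w1 erefl erefl) => c0.
set eX := update e1 xX p; rewrite run_let eval_pred.
set find2 := EFind xV 1 _; have found2 : eval n m1 eX find2 != 0.
  rewrite eval_find expn1 last_index_neq0; apply/existsP; exists q0.
  by rewrite (@eval_conflict m1 _ 5 2 (Ordinal lt_p, q0) in1 w1 erefl erefl).
have [] := eval_findP found2; set q := (eval n m1 eX find2).-1 => lt_q.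
pose x : 'I_n * 'I_n := (Ordinal lt_p, Ordinal lt_q).
rewrite (@eval_conflict m1 _ 5 2 x in1 w1 erefl erefl) => /and3P[neq side].
set eY := update eX xY q; rewrite run_let eval_pred.
rewrite (@eval_conflict_length m1 eY 5 6 x w1 erefl erefl) => /last_indexP[].
set l := (conflict_length x).-1 => lt_l; rewrite eqb0 negbK => walk.
set eK := update eY xK l; rewrite run_seq.
have [f [f0 fl ff fm]] := @trace_conflict_correct eK m1 l x in1 w1 erefl erefl erefl lt_l walk.
(* A chain of length 0 would make [x] its own reverse, against [neq]; hence the length is a
   successor. *)
case: l walk lt_l @eK fl ff fm => [|k] walk lt_l eK fl ff fm.
  by case/negP: neq; rewrite eq_sym -[x.2]/(swap x).1 (eqP (walk : swap x == x)).
exists k, f; split=> //; first by rewrite f0.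
  by rewrite f0.
apply: output_asteroid_correct => //; first by rewrite f0.
Qed.
End Correctness.

(** * Input and output words cell by cell *)

Lemma nth_allpairs (S1 S2 : Type) (R : Type) (f : S1 -> S2 -> R) x1 x2 r s t i j :
  i < size s -> j < size t ->
  nth r [seq f x y | x <- s, y <- t] (size t * i + j) = f (nth x1 s i) (nth x2 t j).
Proof.
elim: s i => [|x s IHs] [|i] //= lt_i lt_j; rewrite nth_cat size_map.
  by rewrite muln0 lt_j (nth_map x2).
by rewrite mulnS -addnA ltnNge leq_addr /= addKn IHs.
Qed.

Lemma nth_flatten_pairs (S : Type) (f g : S -> nat) x s i : i < size s ->
  nth 0 (flatten [seq [:: f y; g y] | y <- s]) (2 * i) = f (nth x s i) /\
  nth 0 (flatten [seq [:: f y; g y] | y <- s]) (2 * i).+1 = g (nth x s i).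
Proof.
elim: s i => [|y s IHs] [|i] // lt_i.
by rewrite mulnS !addSn add0n; apply: IHs.
Qed.

Lemma encode_bigraph_input n (G : bigraph 'I_n) : input_in G (nth 0 (encode_bigraph G)).
Proof.
rewrite /encode_bigraph; split=> [u|u v]; rewrite -?addnA add1n /=.
  rewrite nth_cat size_map size_enum_ord ltn_ord (nth_map u) ?size_enum_ord //.
  by rewrite nth_ord_enum.
rewrite nth_cat size_map size_enum_ord ltnNge leq_addr /= addKn.
rewrite -[X in X * u](size_enum_ord n) (nth_allpairs _ u v) ?size_enum_ord //.
by rewrite !nth_ord_enum.
Qed.

Lemma cells_computed n (F : 'I_n * 'I_n -> nat) (m : nat -> nat) :
  m 0 = 1 -> (forall x, m (1 + code x) = F x) ->
  forall i, i < size (1 :: [seq F (u, v) | u <- enum 'I_n, v <- enum 'I_n]) ->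
  m i = nth 0 (1 :: [seq F (u, v) | u <- enum 'I_n, v <- enum 'I_n]) i.
Proof.
move=> m0 mF [|i] //=; rewrite ltnS size_allpairs size_enum_ord => lt_i.
have [[u v] ec] : exists x : 'I_n * 'I_n, i = code x by apply: codeP; rewrite -mulnn.
rewrite -add1n ec mF /code -[X in X * _](size_enum_ord n).
by rewrite (nth_allpairs _ u v) ?size_enum_ord // !nth_ord_enum.
Qed.

Lemma edges_computed n k (e : 'I_k.*2.+1 -> 'I_n * 'I_n) (m : nat -> nat) :
  m 0 = 0 -> m 1 = k ->
  (forall i : 'I_k.*2.+1, m (2 + 2 * i) = (e i).1 /\ m (3 + 2 * i) = (e i).2) ->
  forall i, i < size (encode_no e) -> m i = nth 0 (encode_no e) i.
Proof.
move=> m0 m1 me [|[|i]] //=.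
rewrite !ltnS => lt_i.
have sz (s : seq 'I_k.*2.+1) :
    size (flatten [seq [:: nat_of_ord (e i).1; nat_of_ord (e i).2] | i <- s]) = 2 * size s.
  by elim: s => //= j s ->; rewrite mulnS.
have lt_h : i./2 < k.*2.+1.
  by rewrite sz size_enum_ord in lt_i; have := odd_double_half i; lia.
have [|h1 h2] := @nth_flatten_pairs _ (fun i => nat_of_ord (e i).1)
  (fun i => nat_of_ord (e i).2) ord0 (enum 'I_k.*2.+1) i./2.
  by rewrite size_enum_ord.
have [m1h m2h] := me (Ordinal lt_h).
rewrite (nth_ord_enum _ (Ordinal lt_h)) in h1 h2.
rewrite -(odd_double_half i) -mul2n; case: (odd i).
  by rewrite add1n h2 -m2h.
by rewrite add0n h1 -m1h.
Qed.

Theorem theorem4p2 :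
  (exists (p : program) (a d : nat),
     forall (n : nat) (G : bigraph 'I_n),
       let w := encode_bigraph G in
       let N := a * size w ^ d + a in
       (cocomparability_bigraph G ->
          exists M : mixed_graph 'I_n,
            [/\ orientation_of_complement G M,
                T_free G M
              & computes_within p w N (encode_yes M)]) /\
       (~ cocomparability_bigraph G ->
          exists (k : nat) (e : 'I_k.*2.+1 -> 'I_n * 'I_n),
            weak_edge_asteroid G e /\
            computes_within p w N (encode_no e))) /\
  (forall (T : finType) (G : bigraph T) (k : nat) (e : 'I_k.*2.+1 -> T * T),
     weak_edge_asteroid G e -> ~ cocomparability_bigraph G).
Proof.
have no_asteroid (T : finType) (G : bigraph T) k (e : 'I_k.*2.+1 -> T * T) :
    weak_edge_asteroid G e -> ~ cocomparability_bigraph G.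
  move=> ast [ltX [ltY [linX linY coc]]].
  exact: (linear_orders_no_asteroid linX linY coc ast).
split=> //; have [a [d cost]] := compile_correct recognize.
exists (compile recognize), a, d => n G w N.
have in0 := encode_bigraph_input G.
have small : head 0 w < size w.
  by rewrite /w /= size_cat size_map size_enum_ord ltnS leq_addr.
have [cf|cf] := boolP [exists x, conflicting G x].
  have [k [f [fk side ff [m0 m1 mw]]]] := recognize_no (fun=> 0) in0 cf.
  have ast := invertible_pair_asteroid ff fk side.
  split=> [/(no_asteroid _ _ _ _ ast) // | _].
  exists k, (invertible_pair_edges f); split=> //; apply: cost => //.
  apply: edges_computed m0 m1 _ => i; apply: mw.
  by have := ltn_ord i; lia.
have nc : [forall x, ~~ conflicting G x] by rewrite -negb_exists.
have free : conflict_free G by apply/conflict_freeP => x; apply: (forallP nc).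
split=> [_|]; last by move/(_ (conflict_free_cocomparability free)).
exists (label_orientation G (label G)); split.
- exact: label_orientation_complement (label_swap free).
- exact: label_orientation_T_free (@label_forces _ G).
have [m0 mx] := recognize_yes (fun=> 0) in0 nc.
have -> : encode_yes (label_orientation G (label G)) =
    1 :: [seq orientation_entry G (u, v) | u <- enum 'I_n, v <- enum 'I_n].
  congr (_ :: _); apply: eq_allpairs => u v.
  by rewrite /orientation_entry /=; case: same_side; rewrite //= addn0.
by apply: cost => //; apply: cells_computed.
Qed.
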